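(* Let $p$ be an odd prime and let $\zeta_d$ denote a primitive $d$-th root of unity. Let $n\geq 2$, $m\geq 1$ be integers, let $r$ be an integer with $(r,p^n)=1$ such that $r$ has multiplicative order $p^s$ modulo $p^n$, where $1\leq s\leq \min\{n-1,m\}$, and consider the finite non-abelian split metacyclic $p$-group $$G=\langle a,b\mid a^{p^n}=b^{p^m}=1,\ bab^{-1}=a^r\rangle.$$ Then the Wedderburn decomposition of the rational group algebra $\mathbb{Q}G$ is as follows. \begin{enumerate} \item If $n-s\geq m$, then $$\mathbb{Q}G \cong \mathbb{Q} \bigoplus_{\lambda=1}^m (p^\lambda+p^{\lambda-1})\mathbb{Q}(\zeta_{p^\lambda}) \bigoplus_{\lambda=m+1}^{n-s}p^m \mathbb{Q}(\zeta_{p^\lambda}) \bigoplus_{t=1}^s p^{m-t}M_{p^t}(\mathbb{Q}(\zeta_{p^{n-s}})).$$ \item If $n-s<m$, write $m=(n-s)+k$. \begin{enumerate} \item If $k\leq s$, then \begin{align*} \mathbb{Q}G \cong & \mathbb{Q} \bigoplus_{\lambda=1}^{n-s} (p^\lambda+p^{\lambda-1})\mathbb{Q}(\zeta_{p^\lambda}) \bigoplus_{\lambda=n-s+1}^{m}p^{n-s} \mathbb{Q}(\zeta_{p^\lambda}) \bigoplus_{t=1}^{k-1} p^{n-s}M_{p^t}(\mathbb{Q}(\zeta_{p^{n-s}}))\\ &\bigoplus_{t=1}^{k-1}\bigoplus_{\lambda=n-s+1}^{m-t} (p^{n-s}-p^{n-s-1})M_{p^t}(\mathbb{Q}(\zeta_{p^{\lambda}}))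 \bigoplus_{t=k}^s p^{m-t}M_{p^t}(\mathbb{Q}(\zeta_{p^{n-s}})). \end{align*} \item If $k>s$, then \begin{align*} \mathbb{Q}G \cong & \mathbb{Q} \bigoplus_{\lambda=1}^{n-s} (p^\lambda+p^{\lambda-1})\mathbb{Q}(\zeta_{p^\lambda}) \bigoplus_{\lambda=n-s+1}^{m}p^{n-s} \mathbb{Q}(\zeta_{p^\lambda}) \bigoplus_{t=1}^s p^{n-s}M_{p^t}(\mathbb{Q}(\zeta_{p^{n-s}}))\\ &\bigoplus_{t=1}^s\bigoplus_{\lambda=n-s+1}^{m-t} (p^{n-s}-p^{n-s-1})M_{p^t}(\mathbb{Q}(\zeta_{p^{\lambda}})). \end{align*} \end{enumerate} \end{enumerate}
   Context: $\mathbb{Q}G$ is the rational group algebra of $G$. For a positive integer $c$ and an algebra $A$, the notation $c\,A$ inside a direct sum means the direct sum of $c$ copies of $A$. $M_q(D)$ denotes the ring of $q\times q$ matrices over $D$. Empty direct sums (when the lower index exceeds the upper) are zero. *)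

(* Defs.v *)
From HB Require Import structures.
From mathcomp Require Import all_boot all_order all_algebra all_fingroup.
From mathcomp Require Import algC.
Set Implicit Arguments. Unset Strict Implicit. Unset Printing Implicit Defensive.
Import GRing.Theory Num.Theory.
Local Open Scope ring_scope.

Definition is_mult_order (r : int) (N k : nat) : Prop :=
  (0 < k)%N /\ (r ^+ k == 1 %[mod N%:Z])%Z /\
  (forall j : nat, (0 < j < k)%N -> ~ (r ^+ j == 1 %[mod N%:Z])%Z).

Definition resmod (r : int) (N : nat) : nat := absz (r %% N%:Z)%Z.

(* Rational group algebra QG of a finite group gT (whole type):
   elements are rational functions on gT, i.e. sum_g f(g) g. *)
Definition QG (gT : finGroupType) := {ffun gT -> rat}.
Definition qg_one (gT : finGroupType) : QG gT :=
  [ffun x => if x == 1%g then 1 else 0].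
Definition qg_mul (gT : finGroupType) (f g : QG gT) : QG gT :=
  [ffun x => \sum_(y : gT) f y * g (y^-1 * x)%g].

Definition Qzeta (d : nat) (x : algC) : Prop :=
  exists z : algC, d.-primitive_root z /\
  exists P : {poly rat}, x = (map_poly ratr P).[z].

(* A Wedderburn component list: entries (c, q, d) meaning c copies of
   M_q(Q(zeta_d)). Expanded into a list of blocks (q, d). *)
Definition expand (l : seq (nat * nat * nat)) : seq (nat * nat) :=
  flatten [seq nseq c.1.1 (c.1.2, c.2) | c <- l].

Definition dimsum (l : seq (nat * nat * nat)) : nat :=
  sumn [seq b.1 | b <- expand l].

Fixpoint blk (s : seq nat) (i : nat) : nat :=
  match s with
  | [::] => 0
  | q :: s' => if (i < q)%N then 0 else (blk s' (i - q)).+1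
  end.

(* The direct sum  (+)_{(c,q,d) in l} c M_q(Q(zeta_d))  realised as the
   set of block-diagonal matrices in 'M[algC]_N (N = dimsum l), the k-th
   diagonal block being of size q_k with entries in Q(zeta_{d_k}). *)
Definition in_wedd (l : seq (nat * nat * nat)) (A : 'M[algC]_(dimsum l)) : Prop :=
  let bs := expand l in
  forall i j : 'I_(dimsum l),
    let bi := blk [seq b.1 | b <- bs] i in
    let bj := blk [seq b.1 | b <- bs] j in
    (bi != bj -> A i j = 0) /\ (bi = bj -> Qzeta (nth (0, 0)%N bs bi).2 (A i j)).

Definition QG_wedderburn (gT : finGroupType) (l : seq (nat * nat * nat)) : Prop :=
  exists phi : QG gT -> 'M[algC]_(dimsum l),
    [/\ forall f g : QG gT, phi [ffun x => f x + g x] = phi f + phi g,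
        forall (c : rat) (f : QG gT), phi [ffun x => c * f x] = ratr c *: phi f,
        forall f g : QG gT, phi (qg_mul f g) = phi f *m phi g
      & phi (qg_one gT) = 1%:M] /\
    [/\ injective phi,
        forall f, in_wedd (phi f)
      & forall A, in_wedd A -> exists f, phi f = A].

Definition fam (lo hi : nat) (F : nat -> nat * nat * nat) : seq (nat * nat * nat) :=
  [seq F i | i <- iota lo (hi.+1 - lo)].

Definition wedd_list (p n m s : nat) : seq (nat * nat * nat) :=
  if (m <= n - s)%N then
    [:: (1, 1, 1)]%N
    ++ fam 1 m (fun l => (p ^ l + p ^ l.-1, 1, p ^ l))%N
    ++ fam m.+1 (n - s) (fun l => (p ^ m, 1, p ^ l))%N
    ++ fam 1 s (fun t => (p ^ (m - t), p ^ t, p ^ (n - s)))%N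
  else
    let k := (m - (n - s))%N in
    if (k <= s)%N then
      [:: (1, 1, 1)]%N
      ++ fam 1 (n - s) (fun l => (p ^ l + p ^ l.-1, 1, p ^ l))%N
      ++ fam (n - s).+1 m (fun l => (p ^ (n - s), 1, p ^ l))%N
      ++ fam 1 k.-1 (fun t => (p ^ (n - s), p ^ t, p ^ (n - s)))%N
      ++ flatten [seq fam (n - s).+1 (m - t)
                     (fun l => (p ^ (n - s) - p ^ (n - s).-1, p ^ t, p ^ l))%N
                  | t <- iota 1 k.-1]
      ++ fam k s (fun t => (p ^ (m - t), p ^ t, p ^ (n - s)))%N
    else
      [:: (1, 1, 1)]%N
      ++ fam 1 (n - s) (fun l => (p ^ l + p ^ l.-1, 1, p ^ l))%N
      ++ fam (n - s).+1 m (fun l => (p ^ (n - s), 1, p ^ l))%N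
      ++ fam 1 s (fun t => (p ^ (n - s), p ^ t, p ^ (n - s)))%N
      ++ flatten [seq fam (n - s).+1 (m - t)
                     (fun l => (p ^ (n - s) - p ^ (n - s).-1, p ^ t, p ^ l))%N
                  | t <- iota 1 s].

(* Main.v *)
Require Import Defs.
From mathcomp Require Import all_boot all_order all_algebra all_fingroup.
From mathcomp Require Import algC.
From mathcomp Require Import all_solvable all_field.
From mathcomp Require Import zify ring.

(** With N = n - s, the complex irreducible representations of degree p^t of G are
    determined by w = A^(p^t) and y = B^(p^t), where A and B are the images of a and b:
    w is a p^N-th root of unity (primitive when t > 0) and y is a p^(m-t)-th root of
    unity. If w generates the larger of the groups <w> and <y>, let a act on Z/p^(N+t)
    (p^lam when t = 0) by v |-> v + 1 and b by an affine map v |-> r v + d; if y does,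
    let b act by w' |-> r w' and a by translation on 1 + p^N Z modulo a large power of
    p. In both cases the p^t-th power of the generator acting transitively is central,
    and the eigenspace for the larger root is a monomial representation with entries in
    the field generated by w and y, so that no Schur index appears. One representation
    is taken for each Galois orbit of pairs (w, y).

    The sum of these representations is injective on QG: if an element of QG is killed
    by all of them, then by all their Galois conjugates, and expanding its action on an
    eigenvector of a shows that all its Fourier coefficients vanish. Surjectivity onto
    the block algebra follows from equality of the dimensions over Q. *)

Set Implicit Arguments. Unset Strict Implicit. Unset Printing Implicit Defensive.
Import Order.TTheory GRing.Theory Num.Theory.

(** * Powers of a principal unit *)

Lemma exp1D_modn (x y : nat) : exists c, ((1 + x) ^ y = 1 + x * y + x ^ 2 * c)%N.
Proof.
elim: y => [|y [c IH]]; first by exists 0%N; lia.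
exists (y + c + x * c)%N; rewrite expnS IH; ring.
Qed.

(** Modulo p^(e+2) only the first two binomial terms survive: for 1 < i < p the coefficient gives a
    factor p and the power a factor p^(2e), while the last term is divisible by p^(3e) because p is
    odd. *)
Lemma exp1D_prime_pfactor (p e u : nat) : prime p -> odd p -> (0 < e)%N ->
  exists c, ((1 + p ^ e * u) ^ p = 1 + p ^ e.+1 * (u + p * c))%N.
Proof.
move=> p_pr p_odd e_gt0; set x := (p ^ e * u)%N.
have p_gt2: (2 < p)%N by rewrite odd_prime_gt2.
suff [c Ec]: exists c, ((1 + x) ^ p = 1 + p * x + p ^ e.+2 * c)%N.
  by exists c; rewrite Ec /x !expnS; ring.
rewrite expnDn -(big_mkord xpredT (fun i => 'C(p, i) * (1 ^ (p - i) * x ^ i))%N).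
rewrite big_ltn // big_ltn ?ltnS ?prime_gt0 // !exp1n !mul1n bin0 bin1 expn1.
set S := (\sum_(2 <= i < p.+1) _)%N; suff/dvdnP[c ->]: (p ^ e.+2 %| S)%N.
  by exists c; lia.
rewrite /S big_nat_cond; apply: dvdn_sum => i /andP[/andP[i_gt1 _] _].
rewrite exp1n mul1n.
have [lip|lip] := ltnP i p.
  rewrite expnS; apply: dvdn_mul; first by apply: prime_dvd_bin; lia.
  by rewrite /x expnMn -expnM dvdn_mulr // dvdn_exp2l //; nia.
by rewrite dvdn_mull // /x expnMn -expnM dvdn_mulr // dvdn_exp2l //; nia.
Qed.

Section PrincipalUnit.

Variables (p N u r : nat).
Hypotheses (p_pr : prime p) (p_odd : odd p) (N_gt0 : (0 < N)%N).
Hypotheses (p'u : ~~ (p %| u)%N) (rE : r = (1 + p ^ N * u)%N).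

(** Each passage to the p-th power raises the p-adic valuation of the distance to 1 by exactly
    one. *)
Lemma principal_unit_expn_prime k :
  exists2 c, (r ^ (p ^ k) = 1 + p ^ (N + k) * c)%N & ~~ (p %| c)%N.
Proof.
elim: k => [|k [c Ec p'c]]; first by exists u; rewrite // expn1 addn0 rE.
have [] := @exp1D_prime_pfactor p (N + k) c; rewrite ?addn_gt0 ?N_gt0 // => d Ed.
exists (c + p * d)%N; first by rewrite expnSr expnM Ec Ed addnS.
by rewrite dvdn_addl ?dvdn_mulr.
Qed.

Lemma principal_unit_coprime k : coprime (p ^ k) r.
Proof.
rewrite coprimeXl // prime_coprime // rE -(prednK N_gt0) expnS -mulnA.
by rewrite dvdn_addl ?dvdn_mulr // Euclid_dvd1.
Qed.

(** The class of r has order p^k modulo p^(N+k): to first order, r^(p^k y) - 1 is p^(N+k) c y with c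
    prime to p, which decides the next factor p of the exponent. *)
Lemma principal_unit_expn_eq1 k j :
  (r ^ j == 1 %[mod p ^ (N + k)])%N = (p ^ k %| j)%N.
Proof.
apply/idP/idP; last first.
  case/dvdnP=> y ->; rewrite mulnC expnM; have [c -> _] := principal_unit_expn_prime k.
  have [d ->] := exp1D_modn (p ^ (N + k) * c) y.
  by rewrite -addnA addnC -!mulnA -mulnDr mulnC modnMDl.
elim: k j => [|k IHk] j; first by rewrite dvd1n.
move=> jN; have/dvdnP[y Ej]: (p ^ k %| j)%N.
  have rj_gt0: (0 < r ^ j)%N by rewrite expn_gt0 rE.
  apply: IHk; move: jN; rewrite !eqn_mod_dvd //; apply: dvdn_trans.
  by rewrite dvdn_exp2l // addnS.
rewrite Ej expnS dvdn_pmul2r ?expn_gt0 ?prime_gt0 //.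
move: jN; rewrite Ej mulnC expnM; have [c -> p'c] := principal_unit_expn_prime k.
have [d ->] := exp1D_modn (p ^ (N + k) * c) y.
rewrite eqn_mod_dvd; last by lia.
rewrite -addnA addKn dvdn_addl; last first.
  rewrite dvdn_mulr // expnMn -expnM dvdn_mulr // dvdn_exp2l //; nia.
rewrite addnS expnSr -mulnA dvdn_pmul2l ?expn_gt0 ?prime_gt0 //.
by rewrite Euclid_dvdM // (negPf p'c).
Qed.

Lemma principal_unit_expn_inj k i j :
  (r ^ i == r ^ j %[mod p ^ (N + k)])%N = (i == j %[mod p ^ k])%N.
Proof.
wlog le_ij: i j / (i <= j)%N.
  by move=> W; case/orP: (leq_total i j) => /W // E; rewrite eq_sym E eq_sym.
have r_gt0: (0 < r)%N by rewrite rE.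
rewrite eq_sym [RHS]eq_sym [RHS]eqn_mod_dvd // eqn_mod_dvd; last first.
  by rewrite leq_pexp2l.
have ->: (r ^ j - r ^ i = r ^ i * (r ^ (j - i) - 1))%N.
  by rewrite mulnBr muln1 -expnD subnKC.
rewrite Gauss_dvdr ?coprimeXr ?principal_unit_coprime //.
by rewrite -eqn_mod_dvd ?expn_gt0 ?r_gt0 // principal_unit_expn_eq1.
Qed.

(** By counting: j |-> (r^j - 1) / p^N is injective on residues modulo p^k, hence onto, so r
    generates the principal units. *)
Lemma principal_unit_log k w : (w == 1 %[mod p ^ N])%N ->
  exists j, (r ^ j == w %[mod p ^ (N + k)])%N.
Proof.
have pk0: (0 < p ^ k)%N by rewrite expn_gt0 prime_gt0.
have rN j: r ^ j = (1 + p ^ N * ((r ^ j - 1) %/ p ^ N))%N.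
  rewrite mulnC divnK ?subnKC ?expn_gt0 ?rE // -eqn_mod_dvd ?expn_gt0 // -rE.
  by have := principal_unit_expn_eq1 0 j; rewrite addn0 dvd1n.
have modp a b : (1 + p ^ N * a == 1 + p ^ N * b %[mod p ^ (N + k)])%N
              = (a == b %[mod p ^ k])%N.
  by rewrite eqn_modDl expnD -!muln_modr eqn_pmul2l // expn_gt0 prime_gt0.
pose h (j : 'I_(p ^ k)) : 'I_(p ^ k) :=
  Ordinal (ltn_pmod ((r ^ j - 1) %/ p ^ N) pk0).
have h_inj: injective h.
  move=> i j /(congr1 val) /= /eqP; rewrite -modp -!rN principal_unit_expn_inj.
  by rewrite !modn_small // => /eqP/val_inj.
have w_gt0 : (w == 1 %[mod p ^ N])%N -> (0 < w)%N.
  case: w => // /esym; rewrite mod0n modn_small // -(exp1n N) ltn_exp2r ?prime_gt1 //.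
move=> w1; have [x ->]: exists x, w = (1 + p ^ N * x)%N.
  have := w1; rewrite eqn_mod_dvd ?w_gt0 // => /dvdnP[x Ex].
  by exists x; rewrite mulnC -Ex subnKC ?w_gt0.
have [j Ej] : exists j, h j = Ordinal (ltn_pmod x pk0).
  by exists (invF h_inj (Ordinal (ltn_pmod x pk0))); rewrite f_invF.
exists j; rewrite rN modp; move/(congr1 val): Ej => /= ->.
by rewrite eqxx.
Qed.

End PrincipalUnit.

(** * Monomial representations *)

Local Open Scope ring_scope.

Section MonomialMatrix.

Variables (q h : nat) (z : algC).
Hypotheses (q_gt0 : (0 < q)%N) (zh1 : z ^+ h = 1).

(* A map f of Z/(q h) commuting with the shift by q acts on the q-dimensional eigenspace
   of that shift for the eigenvalue z; this is the matrix of that action. *)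
Definition monomial_mx (f : nat -> nat) : 'M[algC]_q :=
  \matrix_(i, j) if (f j %% q == i)%N then z ^+ (f j %/ q) else 0.

Definition shift_compatible (f : nat -> nat) :=
  forall v, (f (v + q) = f v + q %[mod q * h])%N.

Lemma eq_monomial_mx f g :
  (forall v, (f v = g v %[mod q * h])%N) -> monomial_mx f = monomial_mx g.
Proof.
move=> fg; apply/matrixP=> i j; rewrite !mxE.
have red x : ((x %% (q * h)) %% q = x %% q)%N /\
             z ^+ ((x %% (q * h)) %/ q) = z ^+ (x %/ q).
  have E: (x = x %/ (q * h) * h * q + x %% (q * h))%N.
    by rewrite -mulnA (mulnC h) -divn_eq.
  split; rewrite [in RHS]E ?modnMDl // divnMDl // exprD exprM exprAC.
  by rewrite zh1 expr1n mul1r.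
by have [<- <-] := red (f j); have [<- <-] := red (g j); rewrite fg.
Qed.

Lemma shift_compatible_iter f k v : shift_compatible f ->
  (f (v + k * q) = f v + k * q %[mod q * h])%N.
Proof.
move=> fq; elim: k => [|k IHk]; first by rewrite !addn0.
by rewrite mulSn addnCA addnC fq -modnDml IHk modnDml addnAC -addnA.
Qed.

Lemma shift_compatible_iterf f k :
  shift_compatible f -> shift_compatible (iter k f).
Proof.
move=> fq.
(* Compatibility makes f well defined modulo q h, since q h amounts to h shifts by q. *)
have mono x y : (x = y %[mod q * h] -> f x = f y %[mod q * h])%N.
  wlog le_xy: x y / (x <= y)%N.
    by move=> W xy; case/orP: (leq_total x y) => le; [|symmetry]; apply: W.
  move/esym/eqP; rewrite eqn_mod_dvd // => /dvdnP[c Ec].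
  rewrite -(subnKC le_xy) Ec (_ : c * (q * h) = c * h * q)%N; last by ring.
  rewrite shift_compatible_iter // (_ : c * h * q = c * (q * h))%N; last by ring.
  by rewrite addnC modnMDl.
by elim: k => [|k IHk] v //=; rewrite -fq; apply: mono.
Qed.

Lemma monomial_mxM f g : shift_compatible f ->
  monomial_mx f *m monomial_mx g = monomial_mx (f \o g).
Proof.
(* [red] agrees with f modulo q h, but takes the quotient by q out of f, which is the form that the
   matrix product produces. *)
move=> fq; pose red v := (f (v %% q) + v %/ q * q)%N.
rewrite (@eq_monomial_mx (f \o g) (red \o g)); last first.
  by move=> v /=; rewrite {1}(divn_eq (g v) q) addnC shift_compatible_iter.
apply/matrixP=> i j; rewrite !mxE.
rewrite (bigD1 (Ordinal (ltn_pmod (g j) q_gt0))) //= !mxE /= eqxx big1 ?addr0.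
  rewrite /red addnC modnMDl divnMDl // exprD mulrC.
  by case: ifP; rewrite ?mulr0.
move=> k; rewrite -val_eqE /= !mxE eq_sym => /negPf ->; exact: mulr0.
Qed.

(** Used to read off the scalars A^q and B^q; k = 0 gives the identity matrix. *)
Lemma monomial_mx_shift k : monomial_mx (fun v => v + k * q)%N = (z ^+ k)%:M.
Proof.
apply/matrixP=> i j; rewrite !mxE addnC modnMDl divnMDl // modn_small //.
by rewrite divn_small // addn0 eq_sym val_eqE; case: (i == j).
Qed.

Lemma monomial_mxX f k : shift_compatible f ->
  monomial_mx f ^+ k = monomial_mx (iter k f).
Proof.
move=> fq; elim: k => [|k IHk].
  have := monomial_mx_shift 0; rewrite !expr0 -[RHS]/(1 : 'M_q) => <-.
  by apply: eq_monomial_mx => v /=; rewrite addn0.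
by rewrite exprS IHk -[_ * _]/(_ *m _) monomial_mxM.
Qed.

Lemma Qzeta_monomial_mx d f i j : d.-primitive_root z ->
  Qzeta d (monomial_mx f i j).
Proof.
move=> z_prim; exists z; split=> //; rewrite mxE; case: ifP => _.
  by exists 'X^(f j %/ q); rewrite map_polyXn hornerXn.
by exists 0; rewrite rmorph0 horner0.
Qed.

End MonomialMatrix.

(** The data of a block: the central q-th powers w and y, the group relation, and entries in the
    field of the block. *)
Definition metacyclic_mx (q d r : nat) (w y : algC) (A B : 'M[algC]_q) :=
  [/\ A ^+ q = w%:M, B ^+ q = y%:M, B * A = A ^+ r * B,
      forall i j, Qzeta d (A i j) & forall i j, Qzeta d (B i j)].

Section MetacyclicMatrices.

Variables (p N u r t lam q h : nat) (z : algC).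
Hypotheses (p_pr : prime p) (p_odd : odd p) (N_gt0 : (0 < N)%N).
Hypotheses (p'u : ~~ (p %| u)%N) (rE : r = (1 + p ^ N * u)%N).
Hypotheses (qE : q = (p ^ t)%N) (hE : h = (p ^ lam)%N).
Hypothesis z_prim : h.-primitive_root z.

Let p_gt0 : (0 < p)%N := prime_gt0 p_pr.
Let q_gt0 : (0 < q)%N. Proof. by rewrite qE expn_gt0 p_gt0. Qed.
Let zh1 : z ^+ h = 1 := prim_expr_order z_prim.

Let qhE : (q * h = p ^ (lam + t))%N. Proof. by rewrite qE hE mulnC -expnD. Qed.

Lemma metacyclic_mx_affine e : (lam <= N)%N ->
  exists A B : 'M_q, metacyclic_mx h r z (z ^+ e) A B.
Proof.
(* On Z/p^(lam + t), A is v |-> v + 1 and B is v |-> r v + d, where d is chosen so that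
   B^q is z^e; A^q commutes with B because r = 1 modulo p^lam. *)
move=> lamN; have [c rq p'c] := principal_unit_expn_prime p_pr p_odd N_gt0 p'u rE t.
rewrite -qE in rq.
pose G := (\sum_(i < q) r ^ i)%N.
(* From r^q - 1 = (r - 1) G after cancelling p^N. As p does not divide u, this gives q | G with a
   quotient g prime to p. *)
have GE: (u * G = q * c)%N.
  have /eqP := predn_exp r q; rewrite rq rE -/q /= !add1n /=.
  by rewrite expnD -!mulnA -qE eqn_pmul2l ?expn_gt0 ?p_gt0 // -add1n -rE => /eqP.
have /dvdnP[g Gq]: (q %| G)%N.
  rewrite -(@Gauss_dvdr _ u) ?GE ?dvdn_mulr //.
  by rewrite ?qE ?hE coprimeXl // prime_coprime.
have p'g: ~~ (p %| g)%N.
  apply: contra p'c => pg; rewrite -(@dvdn_pmul2l q) // -GE Gq mulnA mulnC.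
  by rewrite dvdn_mul ?dvdn_mull.
(* d is e / g modulo h, so that B^q sends v to r^q v + d g q, which is v + e q modulo q h. *)
have [d dg]: exists d, (d * g = e %[mod h])%N.
  have co: coprime g h by rewrite coprime_sym ?qE ?hE coprimeXl // prime_coprime.
  case: (posnP g) => [g0|g_gt0]; first by rewrite g0 dvdn0 in p'g.
  case: (egcdnP h g_gt0) => k l kg _; exists (k * e)%N.
  by rewrite mulnAC kg (eqP co) mulnDl mul1n mulnAC modnMDl.
pose fA := succn; pose fB v := (r * v + d)%N.
have fAq: shift_compatible q h fA by [].
have rq1 x: (r ^ q * x = x %[mod q * h])%N.
  have ->: (r ^ q * x = p ^ (N - lam) * c * x * (q * h) + x)%N.
    rewrite rq qhE (_ : N + t = (N - lam) + (lam + t))%N;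
      last by clear -lamN; lia.
    by rewrite expnD; ring.
  by rewrite modnMDl.
have fBq: shift_compatible q h fB.
  move=> v; rewrite /fB mulnDr addnAC; apply/eqP; rewrite eqn_modDl.
  rewrite eqn_mod_dvd ?leq_pmull ?rE // mulnDl mul1n addKn qhE mulnAC qE -expnD.
  by rewrite dvdn_mulr // dvdn_exp2l // leq_add2r.
have iterB k v: iter k fB v = (r ^ k * v + d * \sum_(i < k) r ^ i)%N.
  elim: k => [|k IHk]; first by rewrite big_ord0 mul1n muln0 addn0.
  have ->: (\sum_(i < k.+1) r ^ i = 1 + r * \sum_(i < k) r ^ i)%N.
    rewrite big_ord_recl big_distrr; congr (_ + _)%N.
    by apply: eq_bigr => i _; apply: expnS.
  by rewrite iterS IHk /fB expnS; ring.
exists (monomial_mx q z fA), (monomial_mx q z fB); split.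
- rewrite (monomial_mxX q_gt0 zh1) // -[z in RHS]expr1 -monomial_mx_shift //.
  apply: (eq_monomial_mx q_gt0 zh1) => v; congr (_ %% _)%N.
  by rewrite mul1n iter_succn.
- rewrite (monomial_mxX q_gt0 zh1) // -monomial_mx_shift //.
  apply: (eq_monomial_mx q_gt0 zh1) => v; rewrite iterB -/G -modnDml rq1 modnDml.
  apply/eqP; rewrite eqn_modDl Gq mulnA; apply/eqP.
  by rewrite ![(_ * q)%N]mulnC -!muln_modr dg.
- rewrite (monomial_mxX q_gt0 zh1) // -![_ * _]/(_ *m _).
  rewrite !(monomial_mxM q_gt0 zh1) //; last exact: shift_compatible_iterf.
  apply: (eq_monomial_mx q_gt0 zh1) => v /=; congr (_ %% _)%N.
  by rewrite iter_succn /fB /fA; ring.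
- by move=> i j; apply: Qzeta_monomial_mx.
- by move=> i j; apply: Qzeta_monomial_mx.
Qed.

Lemma metacyclic_mx_log e : (p ^ (lam - N) %| e)%N ->
  exists A B : 'M_q, metacyclic_mx h r (z ^+ e) z A B.
Proof.
(* The index j stands for r^j in 1 + p^N Z modulo p^(N + lam + t): B is multiplication by
   r, and A is translation by c = (r^(q e) - 1) / q, so that A^q acts as r^(q e). *)
move=> pe; have r_gt0: (0 < r)%N by rewrite rE.
have expn_eq1 := principal_unit_expn_eq1 p_pr p_odd N_gt0 p'u rE.
have expn_inj := principal_unit_expn_inj p_pr p_odd N_gt0 p'u rE.
(* Powers of r modulo p^L depend on the exponent exactly modulo p^(lam + t) = q h. *)
pose L := (N + (lam + t))%N.
have [c1 cE]: exists c1, (r ^ (q * e) = 1 + p ^ (maxn N lam + t) * c1)%N.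
  have := expn_eq1 (t + (lam - N))%N (q * e)%N.
  rewrite [(p ^ (t + _))%N]expnD qE dvdn_mul // -qE.
  rewrite eqn_mod_dvd ?expn_gt0 ?r_gt0 // => /dvdnP[c1 Ec1]; exists c1.
  have ->: (maxn N lam + t = N + (t + (lam - N)))%N by clear; lia.
  by rewrite [(_ * c1)%N]mulnC -Ec1 subnKC // expn_gt0 r_gt0.
pose c := (p ^ maxn N lam * c1)%N.
have qc: (r ^ (q * e) = 1 + q * c)%N by rewrite cE /c expnD qE; ring.
(* Divisibility by p^N keeps r^j + c a power of r modulo p^L; divisibility by p^lam makes A
   compatible with the shift by q. *)
have cN: (p ^ N %| c)%N by rewrite dvdn_mulr // dvdn_exp2l // leq_maxl.
have clam: (p ^ lam %| c)%N by rewrite dvdn_mulr // dvdn_exp2l // leq_maxr.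
have rjN j: (p ^ N %| r ^ j - 1)%N.
  by rewrite -eqn_mod_dvd ?expn_gt0 ?r_gt0 // -[N]addn0 expn_eq1 dvd1n.
have fA_ex j: exists i, (r ^ i == r ^ j + c %[mod p ^ L])%N.
  apply: (principal_unit_log p_pr p_odd N_gt0 p'u rE).
  rewrite -modnDmr (eqP cN) addn0 eqn_mod_dvd ?expn_gt0 ?r_gt0 //.
pose fA j := xchoose (fA_ex j).
have fAE j: (r ^ fA j = r ^ j + c %[mod p ^ L])%N by apply/eqP/(xchooseP (fA_ex j)).
have iterE k j: (r ^ iter k fA j = r ^ j + k * c %[mod p ^ L])%N.
  elim: k => [|k IHk]; first by rewrite addn0.
  by rewrite iterS fAE -modnDml IHk modnDml mulSn addnAC -addnA.
have rq1: exists d, (r ^ q = 1 + p ^ (N + t) * d)%N.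
  have [d + _] := principal_unit_expn_prime p_pr p_odd N_gt0 p'u rE t.
  by rewrite -qE; exists d.
pose fB := succn.
have fBq: shift_compatible q h fB by [].
have fAq: shift_compatible q h fA.
  move=> v; apply/eqP; rewrite qhE -expn_inj -/L fAE.
  rewrite [(r ^ (fA v + q))%N]expnD -modnMml fAE modnMml.
  rewrite mulnDl -expnD eqn_modDl; have [d ->] := rq1.
  rewrite mulnDr muln1 -{1}[c]addn0 eqn_modDl mod0n eq_sym.
  have ->: (p ^ L = p ^ lam * p ^ (N + t))%N by rewrite -expnD addnCA.
  by rewrite -[_ == _]/(_ %| _)%N dvdn_mul // dvdn_mulr.
exists (monomial_mx q z fA), (monomial_mx q z fB); split.
- rewrite (monomial_mxX q_gt0 zh1) // -monomial_mx_shift //.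
  apply: (eq_monomial_mx q_gt0 zh1) => v; apply/eqP.
  rewrite qhE -expn_inj -/L iterE expnD [(e * q)%N]mulnC qc mulnDr muln1 eqn_modDl.
  (* The discrepancy (r^v - 1) q c vanishes modulo p^L: p^N divides its first factor and q p^lam
     divides q c. *)
  have ->: (r ^ v * (q * c) = q * c + (r ^ v - 1) * (q * c))%N.
    by rewrite mulnBl mul1n subnKC // leq_pmull // expn_gt0 r_gt0.
  rewrite -{1}[(q * c)%N]addn0 eqn_modDl mod0n eq_sym.
  have ->: (p ^ L = p ^ N * (q * p ^ lam))%N by rewrite -hE qhE -expnD.
  by rewrite -[_ == _]/(_ %| _)%N !dvdn_mul.
- rewrite (monomial_mxX q_gt0 zh1) // -[z in RHS]expr1 -monomial_mx_shift //.
  apply: (eq_monomial_mx q_gt0 zh1) => v; congr (_ %% _)%N.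
  by rewrite mul1n iter_succn.
- rewrite (monomial_mxX q_gt0 zh1) // -![_ * _]/(_ *m _).
  rewrite !(monomial_mxM q_gt0 zh1) //; last exact: shift_compatible_iterf.
  apply: (eq_monomial_mx q_gt0 zh1) => v; apply/eqP; rewrite qhE -expn_inj -/L /=.
  (* r (r^v + c) = r^(v+1) + r c, that is, r translations after B. *)
  rewrite iterE /fB expnS -modnMmr fAE modnMmr mulnDr -expnS //.
- by move=> i j; apply: Qzeta_monomial_mx.
- by move=> i j; apply: Qzeta_monomial_mx.
Qed.

End MetacyclicMatrices.

(** * The metacyclic group *)

Section MetacyclicGroup.

Local Open Scope group_scope.

Variables (k l r : nat) (gT : finGroupType).
Hypotheses (k_gt1 : (1 < k)%N) (l_gt1 : (1 < l)%N) (co_kr : coprime k r).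
Hypothesis rl1 : (r ^ l = 1 %[mod k])%N.

(** This is the action that defines the semidirect product: the r-th power map is invertible as r is
    prime to k, and its order divides l as r^l = 1 modulo k. *)
Lemma power_cycle_aut :
  exists s, [/\ s \in Aut <[Zp1 : 'Z_k]>, (#[s] %| l)%N & s (Zp1 : 'Z_k) = (Zp1 : 'Z_k) ^+ r].
Proof.
set x : 'Z_k := Zp1; have ox: #[x] = k by rewrite order_Zp1 Zp_cast.
have ur: (r%:R : 'Z_#[x])%R \is a GRing.unit by rewrite unitZpE ?ox.
pose v := FinRing.Unit ur; exists (Zp_unitm v); split; first exact: Aut_aut.
  rewrite order_dvdn -morphX ?inE // (_ : v ^+ l = 1) ?morph1 //.
  apply: val_inj; rewrite FinRing.val_unitX /= -natrX.
  by rewrite -Zp_nat_mod ?ox // rl1 modn_small.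
by rewrite autE ?cycle_id //= /cyclem val_Zp_nat ?expg_mod_order // ox.
Qed.

Hypothesis presG : [set: gT] \isog Grp (a : b : a ^+ k, b ^+ l, a ^ b^-1 = a ^+ r).

(** The relation makes <a> normal, so <a><b> is the whole group and has at most k l elements; a
    surjection onto a group of order k l gives the reverse bound. *)
Lemma metacyclic_generators : exists a b : gT,
  [/\ a ^+ k = 1, b ^+ l = 1, b * a = a ^+ r * b & #|gT| = (k * l)%N /\
      forall g, exists i j, g = a ^+ i * b ^+ j].
Proof.
have /existsP[[a b] /= /eqP[genG ak bl ab]] := isoGrp_hom presG.
exists a, b.
have nab: <[b]> \subset 'N(<[a]>).
  by rewrite -cycleV norms_cycle ab mem_cycle.
have GE: <[a]> * <[b]> = [set: gT] by rewrite -norm_joinEr.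
have covG g: exists i j, g = a ^+ i * b ^+ j.
  have: g \in <[a]> * <[b]> by rewrite GE inE.
  by case/mulsgP=> _ _ /cycleP[i ->] /cycleP[j ->] ->; exists i, j.
split=> //; first by rewrite -ab conjgE invgK -!mulgA mulVg mulg1.
split=> //; apply/eqP; rewrite eqn_leq; apply/andP; split.
  rewrite -cardsT -GE.
  rewrite (leq_trans (dvdn_leq _ (dvdn_cardMg _ _))) ?muln_gt0 ?cardG_gt0 //.
  by rewrite leq_mul // dvdn_leq ?(ltnW k_gt1) ?(ltnW l_gt1) // order_dvdn ?ak ?bl.
(* The semidirect product of the cyclic groups is a quotient of gT. *)
have EG := Extremal.Grp l_gt1 k_gt1 power_cycle_aut.
rewrite -cardsT mulnC -(Extremal.card r l_gt1 k_gt1).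
apply: leq_homg; rewrite (presG [set: Extremal.gtype k l r]%G).
have /existsP[[x y] /= /eqP[genE xk yl xy]] := isoGrp_hom EG.
(* The known presentation conjugates by y, the present one by the inverse of b; hence the
   inverse. *)
apply/existsP; exists (x, y^-1); rewrite /= !xpair_eqE invgK xk xy expgVn yl invg1 !eqxx.
by rewrite cycleV genE !eqxx.
Qed.

End MetacyclicGroup.

(** * Eigenvectors and Fourier coefficients *)

(** Injectivity of a Vandermonde matrix: the sums vanish for every polynomial in the nodes, in
    particular for one with all nodes but one as roots. *)
Lemma power_sums_eq0 (F : idomainType) (I : finType) (e y : I -> F) :
  injective e -> (forall c, \sum_i e i ^+ c * y i = 0) -> forall i, y i = 0.
Proof.
move=> e_inj sum0 i.
have polysum (P : {poly F}) : \sum_j P.[e j] * y j = 0.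
  under eq_bigr do rewrite horner_coef big_distrl /=.
  rewrite exchange_big big1 //= => c _; under eq_bigr do rewrite -mulrA.
  by rewrite -big_distrr sum0 /= mulr0.
pose P := \prod_(j | j != i) ('X - (e j)%:P).
have := polysum P; rewrite (bigD1 i) //= big1 => [|j ji].
  rewrite addr0 => /eqP; rewrite mulf_eq0 => /orP[|/eqP//].
  rewrite horner_prod prodf_seq_eq0 => /hasP[j _ /andP[ji]].
  by rewrite hornerXsubC subr_eq0 (inj_eq e_inj) eq_sym (negPf ji).
by rewrite horner_prod (bigD1 j) //= hornerXsubC subrr !mul0r.
Qed.

Lemma fourier_eq0 (F : idomainType) (D : nat) (z : F) (y : nat -> F) :
  D.-primitive_root z -> (forall c, \sum_(x < D) (z ^+ c) ^+ x * y x = 0) ->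
  forall x, (x < D)%N -> y x = 0.
Proof.
move=> z_prim sum0 x ltxD.
apply: (@power_sums_eq0 _ 'I_D (fun i => z ^+ i) (fun i => y i) _ _ (Ordinal ltxD)).
  move=> i j /eqP; rewrite (eq_prim_root_expr z_prim) !modn_small // => /eqP.
  exact: val_inj.
by move=> c; rewrite -[RHS](sum0 c); apply: eq_bigr => i _; rewrite exprAC.
Qed.

Section Eigenvectors.

Variables (p N u r t q : nat).
Hypotheses (p_pr : prime p) (p_odd : odd p) (N_gt0 : (0 < N)%N).
Hypotheses (p'u : ~~ (p %| u)%N) (rE : r = (1 + p ^ N * u)%N) (qE : q = (p ^ t)%N).

Variables (A B : 'M[algC]_q) (zeta eta : algC).
Hypotheses (Aq : A ^+ q = (zeta ^+ q)%:M) (Bq : B ^+ q = eta%:M) (eta0 : eta != 0).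
Hypothesis BA : B * A = A ^+ r * B.
Hypothesis zeta_prim : (0 < t)%N -> (p ^ (N + t)).-primitive_root zeta.

Let q_gt0 : (0 < q)%N. Proof. by rewrite qE expn_gt0 prime_gt0. Qed.

Lemma eigenrowX a (M : 'M[algC]_q) (v : 'rV_q) c :
  v *m M = a *: v -> v *m M ^+ c = a ^+ c *: v.
Proof.
move=> vM; elim: c => [|c IHc]; first by rewrite !expr0 scale1r [LHS]mulmx1.
by rewrite exprS -mulmxE mulmxA vM -scalemxAl IHc scalerA -exprS.
Qed.

Lemma eigenrow_expBq (v : 'rV_q) y : v *m B ^+ (q * y) = eta ^+ y *: v.
Proof. by rewrite exprM; apply: eigenrowX; rewrite Bq mul_mx_scalar. Qed.

(** B permutes the eigenspaces of A, raising the eigenvalue to the power r. *)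
Lemma eigenrow_conj a (v : 'rV_q) j :
  v *m A = a *: v -> (v *m B ^+ j) *m A = a ^+ (r ^ j) *: (v *m B ^+ j).
Proof.
move=> vA; elim: j => [|j IHj]; first by rewrite expr0 expr1 [v *m 1]mulmx1.
have BA' : B *m A = A ^+ r *m B := BA.
rewrite exprSr -mulmxE -!mulmxA BA' !mulmxA.
by rewrite (eigenrowX _ IHj) -scalemxAl -exprM -expnSr.
Qed.

Lemma mulmx_expB_eq0 (v : 'rV_q) j : v *m B ^+ j = 0 -> v = 0.
Proof.
move=> vB0; have: eta ^+ j *: v = 0.
  rewrite -eigenrow_expBq -(subnKC (leq_pmull j q_gt0)) exprD -mulmxE mulmxA.
  by rewrite vB0 mul0mx.
by move/eqP; rewrite scaler_eq0 expf_eq0 (negPf eta0) andbF => /eqP.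
Qed.

(** Any eigenvalue a of A has a^q = zeta^q. For t > 0 this gives zeta = a^e with e = 1 modulo p^N,
    so e is some r^j modulo p^(N+t), and B^j carries an eigenvector for a to one for zeta. *)
Lemma exists_eigenrow : exists2 v : 'rV_q, v *m A = zeta *: v & v != 0.
Proof.
have [a /eigenvalueP[v vA v0]] := eigenvalue_closed A q_gt0.
have aq: a ^+ q = zeta ^+ q.
  apply/eqP; rewrite -subr_eq0; have := eigenrowX q vA.
  rewrite Aq mul_mx_scalar => /eqP; rewrite eq_sym -subr_eq0 -scalerBl.
  by rewrite scaler_eq0 (negPf v0) orbF.
have [t0|t_gt0] := posnP t.
  have q1: q = 1%N by rewrite qE t0.
  suff ->: zeta = a by exists v.
  by have := aq; rewrite {}q1 !expr1.
have z_prim := zeta_prim t_gt0.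
have aqX i : a ^+ (q * p ^ i) = zeta ^+ (q * p ^ i) by rewrite !exprM aq.
have NtE: (p ^ (N + t) = q * p ^ N)%N by rewrite qE mulnC -expnD.
(* A smaller order of a would divide p^(N+t-1), and zeta^(q p^(N-1)) would be 1. *)
have a_prim: (p ^ (N + t)).-primitive_root a.
  have a1: a ^+ (p ^ (N + t)) = 1 by rewrite NtE aqX -NtE prim_expr_order.
  have [|d d_prim d_dvd] := prim_order_exists _ a1.
    by rewrite expn_gt0 prime_gt0.
  have /(dvdn_pfactor _ _ p_pr)[i le_i Ed] := d_dvd; rewrite Ed in d_prim.
  have [->//|ltiNt] := eqVneq (N + t)%N i.
  have: a ^+ (q * p ^ N.-1) = 1.
    apply/eqP; rewrite -(prim_order_dvd d_prim) qE -expnD dvdn_exp2l //.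
    by clear -le_i ltiNt N_gt0; lia.
  rewrite aqX => /eqP; rewrite -(prim_order_dvd z_prim) qE -expnD.
  by rewrite dvdn_Pexp2l ?prime_gt1 //; clear -N_gt0; lia.
have [e ze]: exists e, zeta = a ^+ e.
  have [e ->] := prim_rootP a_prim (prim_expr_order z_prim); by exists e.
have e1: (e == 1 %[mod p ^ N])%N.
  have: (q * e == q * 1 %[mod p ^ (N + t)])%N.
    by rewrite -(eq_prim_root_expr a_prim) muln1 mulnC exprM -ze aq.
  by rewrite NtE -!muln_modr eqn_pmul2l.
have [j rj] := principal_unit_log p_pr p_odd N_gt0 p'u rE t e1.
exists (v *m B ^+ j); last by apply: contraNneq v0 => /mulmx_expB_eq0/eqP.
rewrite (eigenrow_conj _ vA) ze; congr (_ *: _).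
by apply/eqP; rewrite (eq_prim_root_expr a_prim).
Qed.

Lemma big_ord_mul (V : nmodType) (c d : nat) (G : nat -> V) :
  \sum_(y < c * d) G y = \sum_(j < c) \sum_(y < d) G (j + c * y)%N.
Proof.
rewrite exchange_big /=; elim: d => [|d IHd]; first by rewrite muln0 !big_ord0.
rewrite mulnS addnC big_split_ord big_ord_recr /= -IHd; congr (_ + _).
by apply: eq_bigr => j _; rewrite addnC.
Qed.

(** Applied to an eigenvector v, the sum becomes a combination of the vectors v B^j for j < q. These
    have distinct eigenvalues, so each coefficient vanishes. *)
Lemma metacyclic_mx_sum_eq0 (k h : nat) (F : nat -> nat -> algC) :
  \sum_(x < k) \sum_(y < q * h) F x y *: (A ^+ x * B ^+ y) = 0 ->
  forall l, (l < q)%N ->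
  \sum_(x < k) \sum_(y < h) F x (l + q * y)%N * zeta ^+ x * eta ^+ y = 0.
Proof.
move=> sum0 l ltlq; have [v vA v0] := exists_eigenrow.
pose S l := \sum_(x < k) \sum_(y < h) F x (l + q * y)%N * zeta ^+ x * eta ^+ y.
have vBq y j: v *m B ^+ (j + q * y) = eta ^+ y *: (v *m B ^+ j).
  by rewrite addnC exprD -mulmxE mulmxA eigenrow_expBq -scalemxAl.
(* Multiplying further by A^c turns the relation into power sums of the eigenvalues. *)
have sumS c: \sum_(j < q) (zeta ^+ (r ^ j)) ^+ c *: (S j *: (v *m B ^+ j)) = 0.
  have := congr1 (fun M => v *m M *m A ^+ c) sum0.
  rewrite mulmx0 mul0mx => E0; rewrite -[RHS]E0 {E0}.
  rewrite mulmx_sumr mulmx_suml; under [RHS]eq_bigr => x _.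
    rewrite (big_ord_mul _ _ (fun y => F x y *: (A ^+ x * B ^+ y))).
    rewrite mulmx_sumr mulmx_suml.
    under eq_bigr => j _.
      rewrite mulmx_sumr mulmx_suml.
      under eq_bigr => y _.
        rewrite -scalemxAr -scalemxAl -mulmxE mulmxA (eigenrowX x vA) -!scalemxAl vBq.
        rewrite -!scalemxAl (eigenrowX c (eigenrow_conj j vA)) !scalerA mulrC.
      over.
      rewrite -scaler_suml -mulr_sumr.
    over.
  over.
  rewrite exchange_big; apply: eq_bigr => j _ /=.
  by rewrite -scaler_suml -mulr_sumr scalerA.
have /rV0Pn[i vi] : v *m B ^+ l != 0 by apply: contraNneq v0 => /mulmx_expB_eq0/eqP.
have inj_e : injective (fun j : 'I_q => zeta ^+ (r ^ j)).
  move=> j j' /eqP; have [t0|t_gt0] := posnP t.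
    by move=> _; apply: val_inj; case: j j' => j + [j' +]; rewrite qE t0 /=; lia.
  rewrite (eq_prim_root_expr (zeta_prim t_gt0)).
  rewrite (principal_unit_expn_inj p_pr p_odd N_gt0 p'u rE) -qE !modn_small //.
  by move=> /eqP/val_inj.
have := power_sums_eq0 (y := fun j : 'I_q => S j * (v *m B ^+ j) 0 i) inj_e.
move=> /(_ _ (Ordinal ltlq)) /= SB0; apply/eqP; rewrite -/(S l).
suff: S l * (v *m B ^+ l) 0 i == 0 by rewrite mulf_eq0 (negPf vi) orbF.
rewrite SB0 // => c; have := congr1 (fun M : 'rV_q => M 0 i) (sumS c).
rewrite summxE !mxE => {2}<-; apply: eq_bigr => j _; by rewrite !mxE.
Qed.

End Eigenvectors.

(** * Normal forms of group elements and the representations built on them *)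

Section NormalForm.

Variables (gT : finGroupType) (a b : gT) (k l r : nat).
Hypotheses (k_gt0 : (0 < k)%N) (l_gt0 : (0 < l)%N).
Hypotheses (ak : (a ^+ k = 1)%g) (bl : (b ^+ l = 1)%g) (ba : (b * a = a ^+ r * b)%g).
Hypotheses (oG : #|gT| = (k * l)%N).
Hypothesis spanG : forall g : gT, exists i j, g = (a ^+ i * b ^+ j)%g.

Definition normal_form (x : 'I_k * 'I_l) : gT := (a ^+ x.1 * b ^+ x.2)%g.

Lemma normal_form_bij : bijective normal_form.
Proof.
have [h hK]: exists h : gT -> 'I_k * 'I_l, forall g, normal_form (h g) = g.
  apply: (fin_all_exists (P := fun g x => normal_form x = g)) => g.
  have [i [j ->]] := spanG g.
  exists (Ordinal (ltn_pmod i k_gt0), Ordinal (ltn_pmod j l_gt0)).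
  by rewrite /normal_form /= !expg_mod.
have h_bij: bijective h.
  by apply: inj_card_bij (can_inj hK) _; rewrite card_prod !card_ord oG.
exact: (bij_can_bij h_bij (f' := normal_form) hK).
Qed.

Lemma big_normal_form (V : nmodType) (F : gT -> V) :
  \sum_g F g = \sum_(x < k) \sum_(y < l) F (a ^+ x * b ^+ y)%g.
Proof.
by rewrite (reindex normal_form) ?pair_big //; apply/onW_bij/normal_form_bij.
Qed.

Lemma expg_comm_ba i j : (b ^+ j * a ^+ i = a ^+ (r ^ j * i) * b ^+ j)%g.
Proof.
elim: j i => [|j IHj] i; first by rewrite mul1g mulg1 mul1n.
have ba_i : (b * a ^+ i = a ^+ (r * i) * b)%g.
  elim: i => [|i IHi]; first by rewrite muln0 mulg1 mul1g.
  by rewrite expgSr mulgA IHi -mulgA ba mulgA -expgD mulnS addnC.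
by rewrite expgSr -mulgA ba_i mulgA IHj -mulgA -expgSr mulnA -expnSr.
Qed.

Lemma expr_comm_ba (R : pzRingType) (A B : R) i j :
  B * A = A ^+ r * B -> B ^+ j * A ^+ i = A ^+ (r ^ j * i) * B ^+ j.
Proof.
move=> BA; elim: j i => [|j IHj] i; first by rewrite mul1r mulr1 mul1n.
have BA_i : B * A ^+ i = A ^+ (r * i) * B.
  elim: i => [|i IHi]; first by rewrite muln0 mulr1 mul1r.
  by rewrite exprSr mulrA IHi -mulrA BA mulrA -exprD mulnS addnC.
by rewrite exprSr -mulrA BA_i mulrA IHj -mulrA -exprSr mulnA -expnSr.
Qed.

(** The map is defined on normal forms; it is multiplicative because A and B obey the same exchange
    rule as a and b. *)
Lemma metacyclic_rep (R : pzRingType) (A B : R) :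
  A ^+ k = 1 -> B ^+ l = 1 -> B * A = A ^+ r * B ->
  exists rho : gT -> R,
    [/\ rho 1%g = 1, forall g h, rho (g * h)%g = rho g * rho h
      & forall i j, rho (a ^+ i * b ^+ j)%g = A ^+ i * B ^+ j].
Proof.
move=> Ak Bl BA; have [nf nfK Knf] := normal_form_bij.
pose rho g := A ^+ (nf g).1 * B ^+ (nf g).2.
have rhoE i j : rho (a ^+ i * b ^+ j)%g = A ^+ i * B ^+ j.
  pose x : 'I_k * 'I_l := (Ordinal (ltn_pmod i k_gt0), Ordinal (ltn_pmod j l_gt0)).
  have ->: (a ^+ i * b ^+ j = normal_form x)%g by rewrite /normal_form /= !expg_mod.
  by rewrite /rho nfK /= !expr_mod.
exists rho; split=> //; first by have := rhoE 0 0; rewrite !mulg1 !mulr1.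
move=> g h; have [i [j ->]] := spanG g; have [i' [j' ->]] := spanG h.
have ->: (a ^+ i * b ^+ j * (a ^+ i' * b ^+ j') = a ^+ (i + r ^ j * i') * b ^+ (j + j'))%g.
  by rewrite -mulgA (mulgA (b ^+ j)%g) expg_comm_ba !expgD !mulgA.
by rewrite !rhoE -mulrA (mulrA (B ^+ j)) (expr_comm_ba _ _ BA) !exprD !mulrA.
Qed.

End NormalForm.

(** * Block-diagonal representations *)

Section RationalSpan.

Variables (V : lmodType algC) (I J : finType) (v : I -> V) (u : J -> V).
Hypothesis card_IJ : #|J| = #|I|.
Hypothesis v_free : forall c : I -> rat, \sum_i ratr (c i) *: v i = 0 -> forall i, c i = 0.
Hypothesis v_span : forall i, exists c : J -> rat, v i = \sum_j ratr (c j) *: u j.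

(** A dimension argument over Q: the square matrix expressing the independent v in terms of the u
    has full rank, hence is invertible. *)
Lemma rational_span_full j : exists c : I -> rat, u j = \sum_i ratr (c i) *: v i.
Proof.
have [m mE] := fin_all_exists v_span.
pose M : 'M[rat]_(#|I|, #|J|) := \matrix_(x, y) m (enum_val x) (enum_val y).
have /eqP rM : row_free M.
  apply: inj_row_free => w wM; apply/rowP=> x; rewrite mxE.
  pose c i := w 0 (enum_rank i).
  suff /v_free/(_ (enum_val x)) : \sum_i ratr (c i) *: v i = 0.
    by rewrite /c enum_valK.
  under eq_bigr => i _ do rewrite mE scaler_sumr.
  rewrite exchange_big big1 //= => y _.
  under eq_bigr => i _ do rewrite scalerA -rmorphM.
  rewrite -scaler_suml -rmorph_sum.
  have /rowP/(_ (enum_rank y)) := wM; rewrite !mxE => wMy.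
  rewrite (_ : \sum_i _ = 0) ?rmorph0 ?scale0r // -[RHS]wMy.
  rewrite [RHS](reindex (@enum_rank I)) /=; last exact/onW_bij/enum_rank_bij.
  by apply: eq_bigr => i _; rewrite /c mxE !enum_rankK.
have /row_fullP[M' M'M] : row_full M by rewrite /row_full rM card_IJ.
have M'm y : \sum_i M' (enum_rank j) (enum_rank i) * m i y = (j == y)%:R.
  have /matrixP/(_ (enum_rank j) (enum_rank y)) := M'M.
  rewrite !mxE (inj_eq enum_rank_inj) => <-.
  rewrite [RHS](reindex (@enum_rank I)) /=; last exact/onW_bij/enum_rank_bij.
  by apply: eq_bigr => i _; rewrite mxE !enum_rankK.
exists (fun i => M' (enum_rank j) (enum_rank i)).
under eq_bigr => i _ do rewrite mE scaler_sumr.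
rewrite exchange_big /= (bigD1 j) //= [X in _ + X]big1 ?addr0 => [|y yj].
  under eq_bigr => i _ do rewrite scalerA -rmorphM.
  by rewrite -scaler_suml -rmorph_sum M'm eqxx rmorph1 scale1r.
under eq_bigr => i _ do rewrite scalerA -rmorphM.
by rewrite -scaler_suml -rmorph_sum M'm eq_sym (negPf yj) rmorph0 scale0r.
Qed.

End RationalSpan.

(** The root used for x is a power z^k, so X^k is substituted and the result reduced modulo the
    cyclotomic polynomial. *)
Lemma Qzeta_span d (z x : algC) : d.-primitive_root z -> Qzeta d x ->
  exists c : nat -> rat, x = \sum_(e < totient d) ratr (c e) * z ^+ e.
Proof.
move=> z_prim [z' [z'_prim [P ->]]].
have [k ->] := prim_rootP z_prim (prim_expr_order z'_prim).
pose Phi : {poly rat} := map_poly intr 'Phi_d.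
pose Q := (P \Po 'X^k) %% Phi.
have PhiE : map_poly ratr Phi = cyclotomic z d :> {poly algC}.
  rewrite -(Cintr_Cyclotomic z_prim) -map_poly_comp.
  by apply: eq_map_poly => c; rewrite /= ratr_int.
have Phi_z : (map_poly ratr Phi).[z] = 0.
  by rewrite PhiE; apply/eqP; rewrite -/(root _ _) root_cyclotomic.
have sPhi : size Phi = (totient d).+1.
  by rewrite -(size_map_poly (ratr : {rmorphism rat -> algC})) PhiE size_cyclotomic.
have sQ : (size (map_poly ratr Q : {poly algC}) <= totient d)%N.
  by rewrite size_map_poly -ltnS -sPhi ltn_modp -size_poly_eq0 sPhi.
exists (fun e => Q`_e).
transitivity (map_poly ratr Q).[z].
  have := congr1 (fun R => (map_poly ratr R : {poly algC}).[z]) (divp_eq (P \Po 'X^k) Phi).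
  rewrite /= rmorphD rmorphM /= hornerD hornerM Phi_z mulr0 add0r => <-.
  by rewrite map_comp_poly map_polyXn horner_comp hornerXn.
by rewrite (horner_coef_wide _ sQ); apply: eq_bigr => e _; rewrite coef_map.
Qed.

(** [Qzeta] allows a different primitive root for each element; this lets one fixed root serve for
    all. *)
Lemma Qzeta_horner d (z x : algC) : d.-primitive_root z -> Qzeta d x ->
  exists P : {poly rat}, x = (map_poly ratr P).[z].
Proof.
move=> z_prim /(Qzeta_span z_prim)[c ->].
exists (\sum_(e < totient d) c e *: 'X^e).
rewrite rmorph_sum horner_sum; apply: eq_bigr => e _.
by rewrite /= map_polyZ map_polyXn hornerZ hornerXn.
Qed.

Section Blocks.

(** The position of an index inside its block, complementing [blk]. *)
Fixpoint off (s : seq nat) (i : nat) : nat :=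
  match s with
  | [::] => i
  | q :: s' => if (i < q)%N then i else off s' (i - q)
  end.

Lemma blk_off_lt s i : (i < sumn s)%N ->
  (blk s i < size s)%N /\ (off s i < nth 0%N s (blk s i))%N.
Proof.
elim: s i => [|q s IHs] //= i lt_i; case: (ltnP i q) => //= le_qi.
by have := IHs (i - q)%N; rewrite ltn_subLR // => /(_ lt_i)[].
Qed.

Lemma blk_off_inj s i j : blk s i = blk s j -> off s i = off s j -> i = j.
Proof.
elim: s i j => [|q s IHs] //= i j; case: (ltnP i q) => // qi; case: (ltnP j q) => // qj.
by move=> [/IHs E] /E {E}; lia.
Qed.

Lemma blk_off_surj s k o : (k < size s)%N -> (o < nth 0%N s k)%N ->
  exists i, [/\ (i < sumn s)%N, blk s i = k & off s i = o].
Proof.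
elim: s k => [|q s IHs] //= [_ /= ltoq|k].
  by exists o; rewrite ltoq ltn_addr.
move=> /IHs/[apply] -[i [lti <- <-]]; exists (q + i)%N.
by rewrite ltn_add2l lti [(q + i < q)%N]ltnNge leq_addr /= addKn.
Qed.

Lemma big_blk (V : Type) (idx : V) (op : Monoid.law idx) s (F : nat -> nat -> V) :
  \big[op/idx]_(i < sumn s) F (blk s i) (off s i)
    = \big[op/idx]_(k < size s) \big[op/idx]_(o < nth 0%N s k) F k o.
Proof.
elim: s F => [|q s IHs] F; first by rewrite !big_ord0.
rewrite big_split_ord big_ord_recl /=; congr (op _ _).
  by apply: eq_bigr => i _; rewrite ltn_ord.
under [RHS]eq_bigr do rewrite /bump /= add1n.
rewrite -(IHs (fun k => F k.+1)); apply: eq_bigr => i _.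
by rewrite ltnNge leq_addr /= addKn.
Qed.

End Blocks.

Section BlockDiagonal.

Variables (gT : finGroupType) (l : seq (nat * nat * nat)).
Variable rho : nat -> gT -> nat -> nat -> algC.

Let bs := expand l.
Let s := [seq b.1 | b <- bs].
Let dim k := nth 0%N s k.
Let cond k := (nth (0, 0)%N bs k).2.
Let inb k i j := [&& k < size s, i < dim k & j < dim k]%N.

Hypothesis cond_gt0 : forall k, (k < size s)%N -> (0 < cond k)%N.
Hypothesis rho1 : forall k i j, inb k i j -> rho k 1%g i j = (i == j)%:R.
Hypothesis rhoM : forall k g h i j, inb k i j ->
  rho k (g * h)%g i j = \sum_(o < dim k) rho k g i o * rho k h o j.
Hypothesis rhoQ : forall k g i j, inb k i j -> Qzeta (cond k) (rho k g i j).
Hypothesis rho_faithful : forall f : gT -> rat,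
  (forall k i j, inb k i j -> \sum_g ratr (f g) * rho k g i j = 0) -> forall g, f g = 0.
Hypothesis cardG : #|gT| = (\sum_(k < size s) dim k * dim k * totient (cond k))%N.

Let rhoQG k (f : gT -> rat) i j := \sum_g ratr (f g) * rho k g i j.

Definition block_rep (f : QG gT) : 'M[algC]_(dimsum l) :=
  \matrix_(i, j) if blk s i == blk s j then rhoQG (blk s i) f (off s i) (off s j) else 0.

Let inb_ord (i j : 'I_(dimsum l)) : blk s i = blk s j -> inb (blk s i) (off s i) (off s j).
Proof.
have [bi oi] := @blk_off_lt s _ (ltn_ord i); have [bj oj] := @blk_off_lt s _ (ltn_ord j).
by move=> E; rewrite /inb bi oi E.
Qed.

Lemma block_repD (f g : QG gT) : block_rep [ffun x => f x + g x] = block_rep f + block_rep g.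
Proof.
apply/matrixP=> i j; rewrite !mxE; case: ifP => _; last by rewrite addr0.
by rewrite /rhoQG -big_split; apply: eq_bigr => x _; rewrite ffunE rmorphD mulrDl.
Qed.

Lemma block_repZ c (f : QG gT) : block_rep [ffun x => c * f x] = ratr c *: block_rep f.
Proof.
apply/matrixP=> i j; rewrite !mxE; case: ifP => _; last by rewrite mulr0.
by rewrite /rhoQG mulr_sumr; apply: eq_bigr => x _; rewrite ffunE rmorphM mulrA.
Qed.

Lemma block_rep1 : block_rep (qg_one gT) = 1%:M.
Proof.
apply/matrixP=> i j; rewrite !mxE; case: eqP => [E|nE]; last first.
  by case: eqVneq => // ij; case: nE; rewrite ij.
rewrite /rhoQG (bigD1 1%g) //= big1 => [|x /negPf x1]; last first.
  by rewrite ffunE x1 rmorph0 mul0r.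
rewrite ffunE eqxx rmorph1 mul1r addr0 rho1 ?inb_ord //; congr (_%:R).
congr nat_of_bool; apply/eqP/eqP => [|->//].
by move/(blk_off_inj E)/val_inj.
Qed.

Lemma rhoQG_mul (f g : QG gT) k i j : inb k i j ->
  rhoQG k (qg_mul f g) i j = \sum_(o < dim k) rhoQG k f i o * rhoQG k g o j.
Proof.
move=> kij; rewrite /rhoQG.
transitivity (\sum_y \sum_z ratr (f y * g z) * rho k (y * z)%g i j).
  rewrite exchange_big /=.
  transitivity (\sum_x \sum_y ratr (f y * g (y^-1 * x)%g) * rho k x i j).
    by apply: eq_bigr => x _; rewrite ffunE rmorph_sum mulr_suml.
  rewrite exchange_big [RHS]exchange_big /=; apply: eq_bigr => y _.
  rewrite (reindex_inj (mulgI y)) /=; apply: eq_bigr => z _.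
  by rewrite mulKg.
under [RHS]eq_bigr => o _.
  rewrite big_distrlr /=.
  over.
rewrite [RHS]exchange_big /=; apply: eq_bigr => y _.
rewrite [RHS]exchange_big /=; apply: eq_bigr => z _.
rewrite rhoM // mulr_sumr; apply: eq_bigr => o _.
by rewrite rmorphM mulrACA.
Qed.

Lemma block_repM (f g : QG gT) : block_rep (qg_mul f g) = block_rep f *m block_rep g.
Proof.
apply/matrixP=> i j; rewrite !mxE.
pose F k o := (if blk s i == k then rhoQG k f (off s i) o else 0) *
              (if k == blk s j then rhoQG k g o (off s j) else 0).
transitivity (\sum_(k < size s) \sum_(o < nth 0%N s k) F k o); last first.
  rewrite -(big_blk _ s F); apply: eq_bigr => h _; rewrite !mxE /F.
  by case: eqVneq => [->|]; rewrite ?mul0r.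
have [bi oi] := @blk_off_lt s _ (ltn_ord i).
(* Only the block containing row i contributes. *)
rewrite (bigD1 (Ordinal bi)) //= [X in _ + X]big1 ?addr0 => [|k /negPf ki]; last first.
  by rewrite big1 // => o _; rewrite /F -(inj_eq val_inj) /= in ki *; rewrite eq_sym ki mul0r.
case: ifP => [Eb|nE]; last by rewrite big1 // => o _; rewrite /F nE mulr0.
rewrite rhoQG_mul; last by apply/inb_ord/eqP.
by apply: eq_bigr => o _; rewrite /F /= eqxx Eb.
Qed.

Lemma block_rep_in_wedd f : in_wedd (block_rep f).
Proof.
move=> i j; rewrite -/bs -/s /=; split => [nE|E]; rewrite mxE; first by rewrite (negPf nE).
rewrite E eqxx -E /rhoQG.
have ijb := inb_ord E; have [bi _ _] := and3P ijb.
have [z z_prim] := C_prim_root_exists (cond_gt0 bi).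
have /fin_all_exists[P PE] : forall g, exists P : {poly rat},
    rho (blk s i) g (off s i) (off s j) = (map_poly ratr P).[z].
  by move=> g; apply: Qzeta_horner z_prim (rhoQ _ ijb).
exists z; split=> //; exists (\sum_g f g *: P g).
rewrite rmorph_sum horner_sum; apply: eq_bigr => g _.
by rewrite /= map_polyZ hornerZ PE.
Qed.

Lemma block_rep_eq0 f : block_rep f = 0 -> forall g, f g = 0.
Proof.
move=> f0; apply: rho_faithful => k i j /and3P[ltk lti ltj].
have [x [ltx xk xi]] := blk_off_surj ltk lti; have [y [lty yk yj]] := blk_off_surj ltk ltj.
have /matrixP/(_ (Ordinal ltx) (Ordinal lty)) := f0; rewrite !mxE /=.
by rewrite xk yk eqxx xi yj.
Qed.

(** The block algebra is spanned over Q by the products of a matrix unit and a power of a root of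
    unity, as many as there are group elements. The images of the latter are independent over Q,
    hence span it too. *)
Lemma block_rep_surj A : in_wedd A -> exists f, block_rep f = A.
Proof.
move=> wA; pose N := dimsum l.
have /fin_all_exists[z z_prim] :
    forall k : 'I_(size s), exists z : algC, (cond k).-primitive_root z.
  by move=> k; have [z] := C_prim_root_exists (cond_gt0 (ltn_ord k)); exists z.
pose kk (i : 'I_N) := Ordinal (proj1 (@blk_off_lt s _ (ltn_ord i))).
(* The number of generators at a matrix position: none outside the blocks. *)
pose cnt (x : 'I_N * 'I_N) := if blk s x.1 == blk s x.2 then totient (cond (blk s x.1)) else 0%N.
pose J := {x : 'I_N * 'I_N & 'I_(cnt x)}.
pose u (y : J) : 'M[algC]_N := z (kk (tag y).1) ^+ tagged y *: delta_mx (tag y).1 (tag y).2.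
have wspan M : in_wedd M -> exists c : J -> rat, M = \sum_y ratr (c y) *: u y.
  move=> wM.
  have /fin_all_exists[c cE] : forall x : 'I_N * 'I_N, exists c : nat -> rat,
      M x.1 x.2 = \sum_(e < cnt x) ratr (c e) * z (kk x.1) ^+ e.
    move=> [i j]; have [M0 MQ] := wM i j; rewrite /cnt /=.
    case: eqP => [E|/eqP nE]; last by exists (fun=> 0); rewrite big_ord0 M0.
    exact: (Qzeta_span (z_prim (kk i)) (MQ E)).
  exists (fun y : J => c (tag y) (tagged y : 'I_(cnt (tag y)))).
  rewrite [LHS]matrix_sum_delta pair_bigA /=.
  transitivity (\sum_x \sum_(e < cnt x)
      ratr (c x e) *: (z (kk x.1) ^+ e *: delta_mx x.1 x.2 : 'M_N)); last first.
    by rewrite (sig_big_dep xpredT (fun=> xpredT)).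
  apply: eq_bigr => x _; rewrite cE scaler_suml; apply: eq_bigr => e _.
  by rewrite scalerA.
pose v g := block_rep [ffun x => (x == g)%:R].
have phiE (c : gT -> rat) : \sum_g ratr (c g) *: v g = block_rep [ffun x => c x].
  apply/matrixP=> i j; rewrite summxE mxE; case: ifP => Eb; last first.
    by rewrite big1 // => g _; rewrite !mxE Eb mulr0.
  apply: eq_bigr => g _; rewrite !mxE Eb ffunE; congr (_ * _).
  rewrite /rhoQG (bigD1 g) //= ffunE eqxx rmorph1 mul1r big1 ?addr0 //.
  by move=> h /negPf hg; rewrite ffunE hg rmorph0 mul0r.
have cardJ : #|{: J}| = #|gT|.
  rewrite cardG card_tagged sumnE big_map big_enum /=.
  under eq_bigr do rewrite card_ord.
  rewrite -(pair_bigA _ (fun i j => cnt (i, j))) /= /cnt /=.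
  pose F k (_ : nat) := (dim k * totient (cond k))%N.
  transitivity (\sum_(i < N) F (blk s i) (off s i)).
    apply: eq_bigr => i _.
    pose G k (_ : nat) := if blk s i == k then totient (cond (blk s i)) else 0%N.
    rewrite (big_blk _ s G) (bigD1 (kk i)) //= [X in (_ + X)%N]big1 => [|k /negPf ki].
      by rewrite /G /kk /= eqxx sum_nat_const card_ord addn0.
    by rewrite -(inj_eq val_inj) /= in ki; rewrite /G eq_sym ki big1.
  rewrite (big_blk _ s F); apply: eq_bigr => k _.
  by rewrite /F sum_nat_const card_ord mulnA.
have v_free (c : gT -> rat) : \sum_g ratr (c g) *: v g = 0 -> forall g, c g = 0.
  by rewrite phiE => /block_rep_eq0 c0 g; have := c0 g; rewrite ffunE.
have v_span g : exists c : J -> rat, v g = \sum_j ratr (c j) *: u j.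
  exact/wspan/block_rep_in_wedd.
have /fin_all_exists[c cE] := rational_span_full cardJ v_free v_span.
have [a ->] := wspan _ wA.
exists [ffun g => \sum_y a y * c y g]; rewrite -phiE.
under eq_bigr => g _.
  rewrite rmorph_sum scaler_suml.
  under eq_bigr => y _ do rewrite rmorphM -scalerA.
  over.
by rewrite exchange_big; apply: eq_bigr => y _; rewrite -scaler_sumr -cE.
Qed.

Lemma QG_wedderburn_of_blocks : QG_wedderburn gT l.
Proof.
exists block_rep; split; split; try exact: block_repD.
- exact: block_repZ.
- exact: block_repM.
- exact: block_rep1.
- move=> f g fg; apply/ffunP=> x; apply/eqP; rewrite -subr_eq0; apply/eqP.
  have := @block_rep_eq0 [ffun x => f x + [ffun x => -1 * g x] x].
  rewrite block_repD block_repZ fg rmorphN1 scaleN1r subrr => /(_ erefl x).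
  by rewrite !ffunE mulN1r.
- exact: block_rep_in_wedd.
- exact: block_rep_surj.
Qed.

End BlockDiagonal.

(** * The list of simple components *)

Lemma big_fam (F : nat * nat * nat -> nat) lo hi G :
  (\sum_(c <- fam lo hi G) F c = \sum_(lo <= i < hi.+1) F (G i))%N.
Proof. by rewrite /fam big_map. Qed.

(** The three cases become one formula, in which ranges that do not occur are empty sums. As F is
    arbitrary, it serves both the dimension count and, through indicator functions, membership. *)
Lemma big_wedd_list (F : nat * nat * nat -> nat) p n m s (N := (n - s)%N) :
  (s <= m)%N ->
  (\sum_(c <- wedd_list p n m s) F c =
     F (1, 1, 1) +
     (\sum_(1 <= lam < (minn N m).+1) F (p ^ lam + p ^ lam.-1, 1, p ^ lam) +
      \sum_((minn N m).+1 <= lam < (maxn N m).+1) F (p ^ minn N m, 1, p ^ lam)) +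
     \sum_(1 <= t < s.+1) (F (p ^ minn N (m - t), p ^ t, p ^ N) +
        \sum_(N.+1 <= lam < (m - t).+1) F (p ^ N - p ^ N.-1, p ^ t, p ^ lam)))%N.
Proof.
have iotaE k : iota 1 k.-1 = index_iota 1 k by rewrite /index_iota subn1.
move=> sm; rewrite /wedd_list -/N; case: ifP => [mN|/negbT]; last rewrite -ltnNge => Nm.
  rewrite !(big_cat, big_cons, big_nil, big_fam) /= addn0 -!addnA.
  rewrite (minn_idPr mN) (maxn_idPl mN); congr (_ + (_ + (_ + _)))%N.
  rewrite big_nat [RHS]big_nat; apply: eq_bigr => t /andP[t1 ts].
  by rewrite (minn_idPr _) ?[X in (_ + X)%N]big_geq ?addn0 //; lia.
rewrite (minn_idPl (ltnW Nm)) (maxn_idPr (ltnW Nm)).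
case: ifP => [ks|/negbT]; last rewrite -ltnNge => sk.
  rewrite !(big_cat, big_cons, big_nil, big_fam, big_flatten, big_map) /= addn0 -!addnA.
  congr (_ + (_ + (_ + _)))%N.
  rewrite (prednK (_ : 0 < m - N)%N) ?subn_gt0 //.
  (* For t < m - N the minimum of N and m - t is N; from t = m - N on it is m - t and the inner sum
     is empty. *)
  rewrite [RHS](big_cat_nat _ (n := (m - N)%N)) /=; [|lia|lia].
  rewrite addnA; congr (_ + _)%N.
    rewrite iotaE -big_split /=.
    rewrite big_nat [RHS]big_nat; apply: eq_bigr => t /andP[t1 ts].
    by rewrite big_fam (minn_idPl _) //; lia.
  rewrite big_nat [RHS]big_nat; apply: eq_bigr => t /andP[t1 ts].
  by rewrite (minn_idPr _) ?[X in (_ + X)%N]big_geq ?addn0 //; lia.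
rewrite !(big_cat, big_cons, big_nil, big_fam, big_flatten, big_map) /= addn0 -!addnA.
congr (_ + (_ + (_ + _)))%N.
rewrite -[iota 1 s]/(iota 1 s.+1.-1) iotaE -big_split /=.
rewrite big_nat [RHS]big_nat; apply: eq_bigr => t /andP[t1 ts].
by rewrite big_fam (minn_idPl _) //; lia.
Qed.

Lemma totient_pexp p lam : prime p -> (0 < lam)%N ->
  totient (p ^ lam) = (p ^ lam - p ^ lam.-1)%N.
Proof.
case: lam => // lam p_pr _; rewrite totient_pfactor //= expnS.
by rewrite -subn1 mulnBl mul1n.
Qed.

Lemma sum_totient_pexp p i j : prime p -> (i <= j)%N ->
  (p ^ i + \sum_(i.+1 <= lam < j.+1) totient (p ^ lam) = p ^ j)%N.
Proof.
move=> p_pr; have p_gt0 := prime_gt0 p_pr; elim: j => [|j IHj].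
  by rewrite leqn0 => /eqP ->; rewrite big_geq // addn0.
rewrite leq_eqVlt => /orP[/eqP->|ltij]; first by rewrite big_geq ?addn0.
rewrite big_nat_recr //= addnA IHj // totient_pfactor // expnS.
by rewrite -mulSn prednK.
Qed.

(** Degree 1 contributes p^(N+m), and degree p^t contributes p^(N+m+t) - p^(N+m+t-1); the total
    telescopes to p^(N+m+s). *)
Lemma wedd_list_dim p n m s : prime p -> (1 <= s)%N -> (s <= minn n.-1 m)%N ->
  (\sum_(c <- wedd_list p n m s) c.1.1 * (c.1.2 * c.1.2 * totient c.2) = p ^ n * p ^ m)%N.
Proof.
move=> p_pr s_gt0; rewrite leq_min => /andP[sn sm]; have p_gt0 := prime_gt0 p_pr.
rewrite big_wedd_list //=; set N := (n - s)%N.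
have N_gt0 : (0 < N)%N by rewrite /N; lia.
have totE lam := @totient_pexp p lam p_pr.
have ple lam : (p ^ lam.-1 <= p ^ lam)%N by rewrite leq_exp2l ?prime_gt1 // leq_pred.
set S1 := (\sum_(1 <= lam < _) _)%N; set S2 := (\sum_(_ <= lam < (maxn N m).+1) _)%N.
have S1E : (1 + S1 = p ^ (minn N m) * p ^ (minn N m))%N.
  rewrite /S1; elim: (minn N m) => [|j IHj]; first by rewrite big_geq.
  rewrite big_nat_recr //= addnA IHj !mul1n totE //= expnS.
  have := leq_pmull (p ^ j) p_gt0; nia.
have -> : (1 * (1 * 1 * totient 1) + (S1 + S2) = p ^ N * p ^ m)%N.
  rewrite addnA [totient 1]/= !mul1n S1E /S2.
  under eq_bigr do rewrite !mul1n.
  rewrite -big_distrr -mulnDr /= sum_totient_pexp ?minn_max //; last by lia.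
  by rewrite -!expnD; congr (_ ^ _)%N; lia.
have tE t : (1 <= t <= s)%N ->
    (p ^ minn N (m - t) * (p ^ t * p ^ t * totient (p ^ N)) +
      \sum_(N.+1 <= lam < (m - t).+1) (p ^ N - p ^ N.-1) * (p ^ t * p ^ t * totient (p ^ lam))
     = p ^ (m + t) * totient (p ^ N))%N.
  move=> /andP[t_gt0 ts]; rewrite -totE //.
  have mtE : (p ^ (m + t) = p ^ (m - t) * (p ^ t * p ^ t))%N.
    by rewrite -!expnD; congr (_ ^ _)%N; lia.
  have [le|gt] := leqP (m - t) N.
    by rewrite big_geq // addn0 mtE mulnA.
  rewrite mtE -(sum_totient_pexp p_pr (ltnW gt)).
  rewrite -big_distrr -big_distrr /=; ring.
rewrite [X in (_ + X)%N](_ : _ = \sum_(1 <= t < s.+1) p ^ (m + t) * totient (p ^ N))%N; last first.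
  by rewrite big_nat [RHS]big_nat; apply: eq_bigr => t; rewrite ltnS; apply: tE.
have sumE j : (p ^ N * p ^ m + \sum_(1 <= t < j.+1) p ^ (m + t) * totient (p ^ N)
    = p ^ N * p ^ m * p ^ j)%N.
  elim: j => [|j IHj]; first by rewrite big_geq // addn0 muln1.
  rewrite big_nat_recr //= addnA IHj totE // addnS.
  have E1 : (p ^ N = p ^ N.-1 + (p ^ N - p ^ N.-1))%N by rewrite subnKC.
  have E2 : (p ^ N = p * p ^ N.-1)%N by rewrite -expnS prednK.
  rewrite !expnS !expnD; move: (p ^ N - _)%N E1 => X E1.
  by rewrite {1}E2 E1; ring.
by rewrite sumE mulnAC -expnD subnK //; lia.
Qed.

(* The algebra of degree p^t matrices over the p^lam-th cyclotomic field occurs exactly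
   when wedd_adm holds, and then wedd_mult times. *)
Definition wedd_adm (N m s t lam : nat) :=
  if t == 0%N then (lam <= maxn N m)%N else (t <= s)%N && (N <= lam <= maxn N (m - t))%N.

Definition wedd_mult (p N m t lam : nat) :=
  if t == 0%N then
    if lam == 0%N then 1%N
    else if (lam <= minn N m)%N then (p ^ lam + p ^ lam.-1)%N else (p ^ minn N m)%N
  else if lam == N then (p ^ minn N (m - t))%N else (p ^ N - p ^ N.-1)%N.

(** Both directions apply the sum formula to an indicator function: a sum of natural numbers is zero
    exactly when all its terms are. *)
Lemma mem_wedd_list p n m s (N := (n - s)%N) x : (s <= m)%N ->
  reflect (exists t lam, wedd_adm N m s t lam /\ x = (wedd_mult p N m t lam, p ^ t, p ^ lam)%N)
    (x \in wedd_list p n m s).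
Proof.
move=> sm; apply: (iffP idP) => [xl|[t [lam [adm xE]]]].
  (* Bounding t and lam makes the condition Boolean, so that its negation can be summed. *)
  pose good y := [exists t : 'I_s.+1, [exists lam : 'I_(maxn N m).+1,
    wedd_adm N m s t lam && (y == (wedd_mult p N m t lam, p ^ t, p ^ lam)%N)]].
  have goodI t lam y : wedd_adm N m s t lam ->
      y = (wedd_mult p N m t lam, p ^ t, p ^ lam)%N -> good y.
    move=> adm ->; have lt_t : (t < s.+1)%N.
      by move: adm; rewrite /wedd_adm; case: eqP => [->//|_ /andP[]].
    have lt_lam : (lam < (maxn N m).+1)%N.
      by move: adm; rewrite /wedd_adm; case: eqP => [_|_ /andP[_]]; lia.
    apply/existsP; exists (Ordinal lt_t); apply/existsP; exists (Ordinal lt_lam).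
    by rewrite adm eqxx.
  suff /hasP : has (fun y => (y == x) && good y) (wedd_list p n m s).
    by case=> _ _ /andP[/eqP-> /existsP[t /existsP[lam /andP[? /eqP?]]]]; exists t, lam.
  suff all_good : all good (wedd_list p n m s).
    by apply/hasP; exists x; rewrite // eqxx (allP all_good).
  have sum0 : (\sum_(c <- wedd_list p n m s) ~~ good c = 0)%N.
    have bad t lam y : wedd_adm N m s t lam ->
      y = (wedd_mult p N m t lam, p ^ t, p ^ lam)%N -> nat_of_bool (~~ good y) = 0%N.
      by move=> A B; rewrite (goodI _ _ _ A B).
    rewrite big_wedd_list // -/N (bad 0 0)%N //; apply/eqP.
    rewrite add0n !addn_eq0 !sum_nat_seq_eq0 -andbA; apply/and3P.
    split; apply/allP=> lam; rewrite mem_index_iota => /andP[lo hi] /=.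
    - have lam0F : (lam == 0)%N = false by lia.
      rewrite (bad 0 lam)%N; [by []|by rewrite /wedd_adm /=; lia|].
      by rewrite /wedd_mult /= lam0F -ltnS hi expn0.
    - have lam0F : (lam == 0)%N = false by lia.
      rewrite (bad 0 lam)%N; [by []|by rewrite /wedd_adm|].
      by rewrite /wedd_mult /= lam0F leqNgt lo expn0.
    move: lam lo hi => t lo hi; have t0F : (t == 0)%N = false by lia.
    rewrite (bad t N); [|by rewrite /wedd_adm t0F; lia|by rewrite /wedd_mult t0F eqxx].
    rewrite add0n sum_nat_seq_eq0; apply/allP => lam.
    rewrite mem_index_iota => /andP[lam1 lam2] /=.
    have lamNF : (lam == N) = false by lia.
    rewrite (bad t lam); [by []|by rewrite /wedd_adm t0F; lia|].
    by rewrite /wedd_mult t0F lamNF.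
  move/eqP: sum0; rewrite sum_nat_seq_eq0 => /allP all0; apply/allP => y /all0 /=.
  by rewrite eqb0 negbK.
apply: contraT => xl; have : (\sum_(c <- wedd_list p n m s) (c == x) == 0)%N.
  by rewrite sum_nat_seq_eq0; apply/allP=> y yl /=; rewrite eqb0; apply: contraNneq xl => <-.
rewrite big_wedd_list // -/N !addn_eq0 !sum_nat_seq_eq0 xE /=.
case/andP=> /and3P[/eqP x0 /allP x1 /allP x2] /allP x3; move: adm; rewrite /wedd_adm.
have [t0|t_gt0] := posnP t; last first.
  move=> /and3P[ts Nlam lamM]; have := x3 t; rewrite mem_index_iota t_gt0 ltnS ts => /(_ isT) /=.
  rewrite addn_eq0 sum_nat_seq_eq0 => /andP[+ /allP x4].
  have t0F : (t == 0)%N = false by lia.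
  rewrite /wedd_mult t0F; have [->|lamN] := eqVneq lam N; first by rewrite eqb0 eqxx.
  move=> _; have := x4 lam; rewrite mem_index_iota /=.
  by rewrite /wedd_mult t0F (negPf lamN) eqb0 eqxx => x5; suff: ~~ true by []; apply: x5; lia.
move=> lamM; move: x0 x1 x2; rewrite t0 /wedd_mult /= expn0.
have [->|lam0] := eqVneq lam 0%N; first by rewrite expn0.
move=> _ x1 x2; have [lemin|ltmin] := leqP lam (minn N m).
  have := x1 lam; rewrite mem_index_iota /= lemin.
  by rewrite eqb0 eqxx => x5; suff: ~~ true by []; apply: x5; lia.
have := x2 lam; rewrite mem_index_iota /= (leqNgt lam (minn N m)) ltmin.
by rewrite eqb0 eqxx => x5; suff: ~~ true by []; apply: x5; lia.
Qed.

(* The label (q, d, i) names the i-th copy of the matrix algebra of degree q over the d-th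
   cyclotomic field, in the order of expand. *)
Definition labels (l : seq (nat * nat * nat)) :=
  flatten [seq [seq (c.1.2, c.2, i) | i <- iota 0 c.1.1] | c <- l].

Lemma map_fst_labels l : [seq b.1 | b <- labels l] = expand l.
Proof.
rewrite map_flatten -map_comp; congr flatten; apply: eq_map => c /=.
by rewrite -map_comp /= -[in RHS](size_iota 0 c.1.1); elim: (iota _ _) => //= _ e ->.
Qed.

Lemma mem_labels l q d i :
  reflect (exists2 c, (c, q, d) \in l & (i < c)%N) ((q, d, i) \in labels l).
Proof.
apply: (iffP flatten_mapP) => [[[[c q'] d'] cl /mapP[j]]|[c cl lt_ic]].
  by rewrite mem_iota => /= ltj [-> -> ->]; exists c.
by exists (c, q, d); rewrite //= map_f // mem_iota.
Qed.

(** * Representatives of the Galois orbits of pairs of roots of unity *)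

Section LabelRoots.

Variables (p N m s E : nat) (Z : algC).
Hypotheses (p_pr : prime p) (N_gt0 : (0 < N)%N) (sm : (s <= m)%N).
Hypotheses (NE : (N <= E)%N) (mE : (m <= E)%N) (Z_prim : (p ^ E).-primitive_root Z).

Let p_gt0 : (0 < p)%N := prime_gt0 p_pr.

Definition prime_power_root lam := Z ^+ (p ^ (E - lam)).

Lemma prime_power_root_prim lam : (lam <= E)%N ->
  (p ^ lam).-primitive_root (prime_power_root lam).
Proof.
move=> lamE; have := dvdn_prim_root Z_prim (dvdn_exp2l p lamE).
by rewrite -expnB ?p_gt0 // -expnB.
Qed.

(* Every Galois orbit of pairs (w, y) contains a pair in which the root of larger order is
   the fixed primitive p^lam-th root; w_type tells whether this root is w. The index i
   enumerates the possible values of the other root. *)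
Definition w_type t lam i := (lam <= N)%N && ((0 < t)%N || (i < p ^ minn lam m)%N).

(** If w is the fixed root, y runs through the roots of order dividing p^(min(lam, m - t)).
    Otherwise, for t > 0, w runs through the primitive p^N-th roots; for t = 0 its order must be
    strictly below p^lam, and if lam <= N the indices already used with w fixed are subtracted. *)
Definition label_exponent t lam i :=
  (if w_type t lam i then p ^ (lam - minn lam (m - t)) * i
   else if 0 < t then p ^ (lam - N) * nth 0 [seq c <- iota 0 (p ^ N) | coprime (p ^ N) c] i
   else p ^ (lam - minn lam.-1 N) * (if lam <= N then i - p ^ minn lam m else i))%N.

Definition label_roots t lam i :=
  let z := prime_power_root lam in
  if w_type t lam i then (z, z ^+ label_exponent t lam i)
  else (z ^+ label_exponent t lam i, z).

Lemma dvdn_label_exponent t lam i :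
  ~~ w_type t lam i -> (p ^ (lam - N) %| label_exponent t lam i)%N.
Proof.
move=> /negPf wF; rewrite /label_exponent wF.
by case: ifP => _; rewrite dvdn_mulr // dvdn_exp2l //; lia.
Qed.

Lemma metacyclic_mx_label u r t lam i : odd p -> ~~ (p %| u)%N -> r = (1 + p ^ N * u)%N ->
  (lam <= E)%N ->
  exists A B : 'M_(p ^ t),
    metacyclic_mx (p ^ lam) r (label_roots t lam i).1 (label_roots t lam i).2 A B.
Proof.
move=> p_odd p'u rE lamE; have z_prim := prime_power_root_prim lamE.
rewrite /label_roots; case: ifP => [wt|/negbT wt] /=.
  apply: (metacyclic_mx_affine p_pr p_odd N_gt0 p'u rE (erefl _) (erefl _) z_prim).
  by have /andP[] := wt.
apply: (metacyclic_mx_log p_pr p_odd N_gt0 p'u rE (erefl _) (erefl _) z_prim).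
exact: dvdn_label_exponent.
Qed.

Lemma label_roots_w_exp t lam i : (lam <= E)%N -> (label_roots t lam i).1 ^+ (p ^ N) = 1.
Proof.
move=> lamE; have z_prim := prime_power_root_prim lamE.
rewrite /label_roots; case: ifP => [/andP[lamN _]|/negbT/dvdn_label_exponent d] /=; apply/eqP.
  by rewrite -(prim_order_dvd z_prim) dvdn_exp2l.
rewrite -exprM -(prim_order_dvd z_prim); apply: dvdn_trans (dvdn_mul d (dvdnn _)).
by rewrite -expnD dvdn_exp2l //; lia.
Qed.

Lemma label_roots_y_exp t lam i : wedd_adm N m s t lam -> (i < wedd_mult p N m t lam)%N ->
  (label_roots t lam i).2 ^+ (p ^ (m - t)) = 1.
Proof.
move=> adm lti.
have lamE : (lam <= E)%N.
  by move: adm; rewrite /wedd_adm; case: ifP => _; [|case/and3P]; lia.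
have z_prim := prime_power_root_prim lamE.
rewrite /label_roots; case: ifP => [wt|wF] /=; apply/eqP.
  rewrite /label_exponent wt -exprM -(prim_order_dvd z_prim) mulnAC -expnD.
  by rewrite dvdn_mulr // dvdn_exp2l //; lia.
rewrite -(prim_order_dvd z_prim) dvdn_exp2l //.
move: adm lti wF; rewrite /wedd_adm /wedd_mult /w_type.
have [t0|t_gt0] := posnP t; last first.
  rewrite andbT => /and3P[_ Nlam lamM] _ /negbT; lia.
rewrite t0 /= subn0 => lamM; have [->//|lam0] := eqVneq lam 0%N.
have [le|gt] := leqP lam (minn N m); first by move=> *; lia.
move=> lti /negbT; rewrite negb_and -leqNgt => /orP[|le]; first by lia.
case: (leqP lam m) => // ltm.
(* If m < lam, there are only p^m indices and w is the fixed root for all of them. *)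
have Em : minn N m = m by lia.
have El : minn lam m = m by lia.
by move: lti le; rewrite Em El ltnNge => /negPf ->.
Qed.

(** As e is prime to p, taking e-th powers permutes the p^j-th roots of unity. *)
Lemma prime_power_root_exp lam j e (y : algC) : (lam <= E)%N -> (j <= lam)%N ->
  coprime e p -> y ^+ (p ^ j) = 1 ->
  exists i, [/\ (i < p ^ j)%N, y = (prime_power_root lam ^+ (p ^ (lam - j) * i)) ^+ e
    & (p ^ j).-primitive_root y = coprime i (p ^ j)].
Proof.
move=> lamE jlam co_e yj; have z_prim := prime_power_root_prim lamE.
have x_prim : (p ^ j).-primitive_root (prime_power_root lam ^+ (p ^ (lam - j) * e)).
  rewrite exprM prim_root_exp_coprime ?coprimeXr //.
  by rewrite expnB // dvdn_prim_root // dvdn_exp2l.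
have [i ->] := prim_rootP x_prim yj; exists i; split; first exact: ltn_ord.
  by rewrite -!exprM mulnAC.
exact: prim_root_exp_coprime.
Qed.

Lemma prime_power_root_conj lam y : (lam <= E)%N -> (p ^ lam).-primitive_root y ->
  exists2 e, coprime e p & y = prime_power_root lam ^+ e.
Proof.
move=> lamE y_prim; have z_prim := prime_power_root_prim lamE.
have [lam0|lam_gt0] := posnP lam.
  exists 1%N; rewrite ?coprime1n // expr1.
  have := prim_expr_order z_prim; have := prim_expr_order y_prim.
  by rewrite lam0 !expr1 => -> ->.
have [i yE] := prim_rootP z_prim (prim_expr_order y_prim); exists (val i) => //.
by move: y_prim; rewrite yE prim_root_exp_coprime // coprime_pexpr.
Qed.

(** The root of larger order, w in case of a tie, is the e-th power of the fixed root; writing the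
    other one as an e-th power too gives the index i. *)
Lemma label_roots_cover t w y :
  (t <= s)%N -> w ^+ (p ^ N) = 1 -> ((0 < t)%N -> (p ^ N).-primitive_root w) ->
  y ^+ (p ^ (m - t)) = 1 ->
  exists lam i e, [/\ wedd_adm N m s t lam, (i < wedd_mult p N m t lam)%N, coprime e p,
    w = (label_roots t lam i).1 ^+ e & y = (label_roots t lam i).2 ^+ e].
Proof.
move=> ts wN w_prim yM.
have ord_pow M (x : algC) : x ^+ (p ^ M) = 1 -> exists2 j, (j <= M)%N & (p ^ j).-primitive_root x.
  have pM0 : (0 < p ^ M)%N by rewrite expn_gt0 p_gt0.
  move=> /(prim_order_exists pM0)[d d_prim /(dvdn_pfactor _ _ p_pr)[j jM dE]].
  by exists j; rewrite -?dE.
have [iy iyM y_prim] := ord_pow _ _ yM.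
have [t0|t_gt0] := posnP t; last first.
  have t0F : (t == 0)%N = false by lia.
  have {}w_prim := w_prim t_gt0.
  have [yN|Ny] := leqP iy N.
    have [e co_e wE] := prime_power_root_conj NE w_prim.
    have yj : y ^+ (p ^ minn N (m - t)) = 1.
      by apply/eqP; rewrite -(prim_order_dvd y_prim) dvdn_exp2l // leq_min yN.
    have [i [lti yE _]] := prime_power_root_exp NE (geq_minl N (m - t)) co_e yj.
    exists N, i, e; rewrite /wedd_adm /wedd_mult /label_roots /label_exponent /w_type.
    by rewrite t0F leqnn t_gt0 ts /= eqxx leq_maxl.
  have iyE : (iy <= E)%N by lia.
  have [e co_e yE] := prime_power_root_conj iyE y_prim.
  have [c [ltc wE w_co]] := prime_power_root_exp iyE (ltnW Ny) co_e wN.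
  pose cs := [seq c <- iota 0 (p ^ N) | coprime (p ^ N) c].
  have c_cs : c \in cs.
    by rewrite mem_filter mem_iota ltc andbT coprime_sym -w_co w_prim.
  exists iy, (index c cs), e.
  rewrite /wedd_adm /wedd_mult /label_roots /label_exponent /w_type.
  rewrite t0F t_gt0 ts (gtn_eqF Ny) (leqNgt iy N) Ny /= nth_index //; split=> //; first by lia.
  rewrite -index_mem in c_cs; apply: leq_trans c_cs _.
  rewrite -totient_pexp // totient_count_coprime size_filter -sum1_count big_mkcond /=.
  by rewrite /index_iota subn0; apply: leq_sum => d _; case: coprime.
have [iw iwN {}w_prim] := ord_pow _ _ wN.
rewrite t0 subn0 in iyM; rewrite t0.
have [yw|wy] := leqP iy iw.
  have iwE : (iw <= E)%N by lia.
  have [e co_e wE] := prime_power_root_conj iwE w_prim.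
  have yj : y ^+ (p ^ minn iw m) = 1.
    by apply/eqP; rewrite -(prim_order_dvd y_prim) dvdn_exp2l // leq_min yw.
  have [i [lti yE _]] := prime_power_root_exp iwE (geq_minl iw m) co_e yj.
  exists iw, i, e; rewrite /wedd_adm /wedd_mult /label_roots /label_exponent /w_type.
  rewrite iwN lti /= subn0; split=> //; first by rewrite leq_max iwN.
  have [iw0|iw0] := eqVneq iw 0%N; first by move: lti; rewrite iw0 min0n.
  have [le|gt] := leqP iw (minn N m).
    by apply: leq_trans lti _; rewrite (minn_idPl _) ?leq_addr //; lia.
  by rewrite (_ : minn N m = minn iw m) //; lia.
have iyE : (iy <= E)%N by lia.
have [e co_e yE] := prime_power_root_conj iyE y_prim.
(* Ties have gone to w, so its order is now strictly smaller than that of y; hence the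
   predecessor. *)
have wj : w ^+ (p ^ minn iy.-1 N) = 1.
  by apply/eqP; rewrite -(prim_order_dvd w_prim) dvdn_exp2l // leq_min iwN andbT; lia.
have le1 : (minn iy.-1 N <= iy)%N by lia.
have [i [lti wE _]] := prime_power_root_exp iyE le1 co_e wj.
have iy0 : (iy == 0)%N = false by lia.
have [le|gt] := leqP iy N.
  have Em : minn iy m = iy by lia.
  (* The first p^iy indices belong to the pairs with w fixed. *)
  exists iy, (p ^ iy + i)%N, e.
  rewrite /wedd_adm /wedd_mult /label_roots /label_exponent /w_type Em.
  have -> : (p ^ iy + i < p ^ iy)%N = false by rewrite ltnNge leq_addr.
  rewrite /= andbF le addKn iy0 leq_min le iyM leq_max le; split=> //.
  by rewrite ltn_add2l; apply: leq_trans lti _; rewrite leq_exp2l ?prime_gt1 //; lia.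
exists iy, i, e; rewrite /wedd_adm /wedd_mult /label_roots /label_exponent /w_type.
rewrite (leqNgt iy N) gt /= iy0 leq_min (leqNgt iy N) gt /= leq_max iyM orbT; split=> //.
by rewrite (_ : minn N m = minn iy.-1 N) //; lia.
Qed.

End LabelRoots.

(** * Assembling the representations *)

Lemma resmod_exp_eq1 (r : int) (M k : nat) : (0 < M)%N ->
  (r ^+ k == 1 %[mod M%:Z])%Z = (resmod r M ^ k == 1 %[mod M])%N.
Proof.
move=> M_gt0; have rE : (resmod r M)%:Z = (r %% M%:Z)%Z.
  by rewrite /resmod gez0_abs // modz_ge0 // eqz_nat -lt0n.
have XE a j : (a%:Z) ^+ j = (a ^ j)%:Z.
  by elim: j => // j IHj; rewrite exprS IHj -PoszM expnS.
by rewrite -modzXm -rE XE !modz_nat.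
Qed.

(** Once r = 1 modulo p, let p^e be the exact power of p in r - 1. The order of r modulo p^n being
    p^s bounds e + s from below by n and e + s - 1 from above by n - 1. *)
Lemma resmod_principal_unit p n s (r : int) : prime p -> odd p -> (0 < s)%N -> (s < n)%N ->
  is_mult_order r (p ^ n) (p ^ s) ->
  exists2 u, ~~ (p %| u)%N & resmod r (p ^ n) = (1 + p ^ (n - s) * u)%N.
Proof.
move=> p_pr p_odd s_gt0 sn [_ [rs rmin]]; have p_gt0 := prime_gt0 p_pr.
have {}rmin : ~~ (resmod r (p ^ n) ^ (p ^ s.-1) == 1 %[mod p ^ n])%N.
  apply/negP; rewrite -resmod_exp_eq1 ?expn_gt0 ?p_gt0 //; apply: rmin.
  by rewrite expn_gt0 p_gt0 ltn_exp2l ?prime_gt1 // ltn_predL.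
rewrite resmod_exp_eq1 ?expn_gt0 ?p_gt0 // in rs; set r0 := resmod _ _ in rs rmin *.
have p_dvd : (p %| p ^ n)%N by rewrite dvdn_exp // (ltn_trans _ sn).
(* By Fermat, r is congruent to r^(p^s) modulo p. *)
have r1p : (r0 = 1 %[mod p])%N.
  have /(congr1 (modn^~ p)) := eqP rs; rewrite !modn_dvdm // => <-.
  elim: (s) => [|j IHj]; first by rewrite expn1.
  by rewrite expnSr expnM fermat_little.
have r0_gt0 : (0 < r0)%N.
  by case: r0 r1p {rs rmin} => // /esym; rewrite mod0n modn_small ?prime_gt1.
have r0_gt1 : (0 < r0 - 1)%N.
  by rewrite subn_gt0; case: r0 rmin r0_gt0 {rs r1p} => [|[|]] //; rewrite exp1n eqxx.
have [u co_u uE] := pfactor_coprime p_pr r0_gt1; set e := logn _ _ in uE.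
have rE : r0 = (1 + p ^ e * u)%N by rewrite mulnC -uE subnKC.
have e_gt0 : (0 < e)%N.
  by rewrite logn_gt0 mem_primes p_pr r0_gt1 -eqn_mod_dvd // r1p eqxx.
have p'u : ~~ (p %| u)%N by rewrite -prime_coprime.
have eq1 := principal_unit_expn_eq1 p_pr p_odd e_gt0 p'u rE.
exists u => //; suff <- : e = (n - s)%N by [].
have dvd_mod a b : (a <= b)%N -> forall x, (x == 1 %[mod p ^ b])%N -> (x == 1 %[mod p ^ a])%N.
  move=> ab x /eqP/(congr1 (modn^~ (p ^ a)%N)); rewrite !modn_dvdm ?dvdn_exp2l // => ->.
  by rewrite eqxx.
have lo : (n <= e + s)%N.
  rewrite leqNgt; apply/negP => lt.
  by have := dvd_mod _ _ lt _ rs; rewrite -addnS eq1 dvdn_Pexp2l ?prime_gt1 // ltnn.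
have hi : (e + s.-1 < n)%N.
  rewrite ltnNge; apply: contra rmin => le; apply: dvd_mod le _ _.
  by rewrite eq1.
clear -lo hi s_gt0; lia.
Qed.

Section FourierFaithful.

Variables (p n m s N u r : nat) (F : nat -> nat -> algC).
Hypotheses (p_pr : prime p) (p_odd : odd p) (N_gt0 : (0 < N)%N).
Hypotheses (p'u : ~~ (p %| u)%N) (rE : r = (1 + p ^ N * u)%N).
Hypotheses (nE : n = (N + s)%N) (sm : (s <= m)%N).
Hypothesis killed : forall t w y, (t <= s)%N -> w ^+ (p ^ N) = 1 ->
  ((0 < t)%N -> (p ^ N).-primitive_root w) -> y ^+ (p ^ (m - t)) = 1 ->
  exists A B : 'M[algC]_(p ^ t),
    [/\ A ^+ (p ^ t) = w%:M, B ^+ (p ^ t) = y%:M, B * A = A ^+ r * B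
      & \sum_(i < p ^ n) \sum_(j < p ^ m) F i j *: (A ^+ i * B ^+ j) = 0].

(** Two Fourier inversions: over the exponent of a, where the order of zeta selects the degree p^t,
    then over the exponent of b within each residue class modulo p^t. *)
Lemma fourier_faithful i j : (i < p ^ n)%N -> (j < p ^ m)%N -> F i j = 0.
Proof.
move=> lti ltj; have p_gt0 := prime_gt0 p_pr.
have pX0 k : (0 < p ^ k)%N by rewrite expn_gt0 p_gt0.
have [x x_prim] := C_prim_root_exists (pX0 n).
apply: (fourier_eq0 (y := F^~ j) x_prim _ lti) => c; set zeta := x ^+ c.
have zn : zeta ^+ (p ^ n) = 1 by rewrite /zeta exprAC (prim_expr_order x_prim) expr1n.
(* t is the excess over N of the exponent of the order of zeta, truncated at 0. *)
have [t ts zeta_w] : exists2 t, (t <= s)%N & zeta ^+ (p ^ (N + t)) = 1 /\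
    ((0 < t)%N -> (p ^ (N + t)).-primitive_root zeta).
  have [d d_prim /(dvdn_pfactor _ _ p_pr)[e en dE]] := prim_order_exists (pX0 n) zn.
  rewrite dE in d_prim; exists (e - N)%N; first by lia.
  split; last by move=> lt; rewrite subnKC // ltnW // -subn_gt0.
  by apply/eqP; rewrite -(prim_order_dvd d_prim) dvdn_exp2l //; lia.
have [zNt z_prim] := zeta_w; set q := (p ^ t)%N.
have wN : (zeta ^+ q) ^+ (p ^ N) = 1 by rewrite -exprM -expnD addnC.
have w_prim : (0 < t)%N -> (p ^ N).-primitive_root (zeta ^+ q).
  move=> /z_prim zp; have := dvdn_prim_root zp (dvdn_exp2l p (leq_addr t N)).
  by rewrite -expnB ?leq_addr // addKn.
have [y y_prim] := C_prim_root_exists (pX0 (m - t)%N).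
have EM : (p ^ m = q * p ^ (m - t))%N by rewrite -expnD subnKC // (leq_trans ts).
have jE : j = (j %% q + q * (j %/ q))%N by rewrite addnC mulnC -divn_eq.
pose S b := \sum_(i < p ^ n) zeta ^+ i * F i (j %% q + q * b)%N.
rewrite jE; apply: (fourier_eq0 (y := S) y_prim).
  move=> c'; have yM : (y ^+ c') ^+ (p ^ (m - t)) = 1.
    by rewrite exprAC (prim_expr_order y_prim) expr1n.
  have [A [B [Aq Bq BA sum0]]] := killed ts wN w_prim yM.
  have y0 : y ^+ c' != 0.
    by apply: contra_eq_neq yM => ->; rewrite expr0n eqn0Ngt pX0 eq_sym oner_neq0.
  rewrite EM in sum0.
  have := metacyclic_mx_sum_eq0 p_pr p_odd N_gt0 p'u rE (erefl _) Aq Bq y0 BA z_prim sum0.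
  move=> /(_ (j %% q)%N); rewrite ltn_pmod ?pX0 // => /(_ isT) E0.
  rewrite -[RHS]E0 [RHS]exchange_big /=; apply: eq_bigr => b _; rewrite mulr_sumr.
  by apply: eq_bigr => a _; rewrite mulrC [_ * F _ _]mulrC.
by rewrite ltn_divLR ?pX0 // mulnC -EM.
Qed.

End FourierFaithful.

(** An automorphism fixes the rational coefficients, so the relation persists while w and y move to
    their conjugates. *)
Lemma galois_mx_sum (u : {rmorphism algC -> algC}) (q M1 M2 r : nat) (w y : algC)
    (F : nat -> nat -> rat) (A B : 'M[algC]_q) :
  A ^+ q = w%:M -> B ^+ q = y%:M -> B * A = A ^+ r * B ->
  \sum_(i < M1) \sum_(j < M2) ratr (F i j) *: (A ^+ i * B ^+ j) = 0 ->
  let A' := map_mx u A in let B' := map_mx u B in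
  [/\ A' ^+ q = (u w)%:M, B' ^+ q = (u y)%:M, B' * A' = A' ^+ r * B'
    & \sum_(i < M1) \sum_(j < M2) ratr (F i j) *: (A' ^+ i * B' ^+ j) = 0].
Proof.
have mapX (M : 'M[algC]_q) k : map_mx u (M ^+ k) = map_mx u M ^+ k.
  elim: k => [|k IHk]; first exact: map_mx1.
  by rewrite !exprS -[in LHS]mulmxE map_mxM IHk mulmxE.
move=> Aq Bq BA sum0 /=; split.
- by rewrite -mapX Aq map_scalar_mx.
- by rewrite -mapX Bq map_scalar_mx.
- by rewrite -mapX -!mulmxE -!map_mxM !mulmxE BA.
transitivity (map_mx u 0 : 'M_q); last exact: map_mx0.
rewrite -[X in map_mx u X]sum0 !raddf_sum; apply: eq_bigr => i _.
rewrite raddf_sum; apply: eq_bigr => j _.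
by rewrite /= map_mxZ fmorph_rat -!mulmxE map_mxM !mapX.
Qed.

(** Indices are natural numbers, with default 0, so that representations of different degrees share
    one type. *)
Definition mx_entry q (M : 'M[algC]_q) (i j : nat) : algC :=
  if insub i is Some i' then if insub j is Some j' then M i' j' else 0 else 0.

Lemma mx_entryE q (M : 'M[algC]_q) (i j : 'I_q) : mx_entry M i j = M i j.
Proof. by rewrite /mx_entry !valK. Qed.

Lemma scalar_mxX q (w : algC) k : (w%:M : 'M_q) ^+ k = (w ^+ k)%:M.
Proof. by elim: k => // k IHk; rewrite !exprS IHk scalar_mxM mulmxE. Qed.

Section QzetaMatrices.

Variable d : nat.
Hypothesis d_gt0 : (0 < d)%N.

Definition Qzeta_mx q (M : 'M[algC]_q) := forall i j, Qzeta d (M i j).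

Lemma Qzeta_mx1 q : Qzeta_mx (1 : 'M_q).
Proof.
have [z z_prim] := C_prim_root_exists d_gt0.
by move=> i j; exists z; split=> //; exists (i == j)%:R; rewrite rmorph_nat hornerMn hornerC mxE.
Qed.

Lemma Qzeta_mxM q (M M' : 'M[algC]_q) : Qzeta_mx M -> Qzeta_mx M' -> Qzeta_mx (M * M').
Proof.
have [z z_prim] := C_prim_root_exists d_gt0.
move=> QM QM' i j; exists z; split=> //; rewrite mxE.
have /fin_all_exists[P PE] : forall k, exists P : {poly rat},
    M i k * M' k j = (map_poly ratr P).[z].
  move=> k; have [P ->] := Qzeta_horner z_prim (QM i k).
  have [P' ->] := Qzeta_horner z_prim (QM' k j).
  by exists (P * P'); rewrite rmorphM hornerM.
by exists (\sum_k P k); rewrite rmorph_sum horner_sum; apply: eq_bigr.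
Qed.

Lemma Qzeta_mxX q (M : 'M[algC]_q) k : Qzeta_mx M -> Qzeta_mx (M ^+ k).
Proof.
move=> QM; elim: k => [|k IHk]; first exact: Qzeta_mx1.
by rewrite exprS; apply: Qzeta_mxM.
Qed.

End QzetaMatrices.

Section MetacyclicWedderburn.

Variables (p n m s N u r : nat) (gT : finGroupType) (a b : gT).
Hypotheses (p_pr : prime p) (p_odd : odd p) (N_gt0 : (0 < N)%N) (s_gt0 : (0 < s)%N).
Hypotheses (p'u : ~~ (p %| u)%N) (rE : r = (1 + p ^ N * u)%N).
Hypotheses (nE : N = (n - s)%N) (sn : (s < n)%N) (sm : (s <= m)%N).
Hypotheses (ak : (a ^+ (p ^ n) = 1)%g) (bl : (b ^+ (p ^ m) = 1)%g) (ba : (b * a = a ^+ r * b)%g).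
Hypothesis oG : #|gT| = (p ^ n * p ^ m)%N.
Hypothesis spanG : forall g : gT, exists i j, g = (a ^+ i * b ^+ j)%g.

Let W := wedd_list p n m s.
Let sz := [seq c.1 | c <- expand W].
Let dim k := nth 0%N sz k.
Let cond k := (nth (0, 0)%N (expand W) k).2.
Let idx k := (nth (0, 0, 0)%N (labels W) k).2.
Let p_gt0 : (0 < p)%N := prime_gt0 p_pr.
Let pX0 k : (0 < p ^ k)%N. Proof. by rewrite expn_gt0 p_gt0. Qed.

Let size_sz : size sz = size (labels W).
Proof. by rewrite size_map -map_fst_labels size_map. Qed.

Let nth_labels k : (k < size sz)%N -> nth (0, 0, 0)%N (labels W) k = (dim k, cond k, idx k).
Proof.
move=> ltk; rewrite /dim /cond /idx /sz (nth_map (0, 0)%N) -?map_fst_labels ?size_map -?size_sz //.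
rewrite (nth_map (0, 0, 0)%N) -?size_sz //.
by case: nth => -[].
Qed.

Let Z := sval (C_prim_root_exists (pX0 (n + m))).
Let Z_prim : (p ^ (n + m)).-primitive_root Z := svalP (C_prim_root_exists (pX0 (n + m))).

Let label_of k t lam := [/\ wedd_adm N m s t lam, dim k = (p ^ t)%N, cond k = (p ^ lam)%N
  & (idx k < wedd_mult p N m t lam)%N].

Let roots t lam i := label_roots p N m (n + m) Z t lam i.

Definition block_spec k (rho : gT -> nat -> nat -> algC) := exists t lam, label_of k t lam /\
  exists A B : 'M[algC]_(dim k),
    metacyclic_mx (cond k) r (roots t lam (idx k)).1 (roots t lam (idx k)).2 A B /\
    exists R : gT -> 'M[algC]_(dim k), [/\ R 1%g = 1, forall g h, R (g * h)%g = R g * R h,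
      forall x y, R (a ^+ x * b ^+ y)%g = A ^+ x * B ^+ y & rho = fun g => mx_entry (R g)].

Lemma wedd_adm_bounds t lam : wedd_adm N m s t lam -> (lam <= n + m)%N /\ (t <= s)%N.
Proof.
by rewrite /wedd_adm; case: eqP => [->|_]; [|case/and3P]; lia.
Qed.

Lemma block_spec_exists k : (k < size sz)%N -> exists rho, block_spec k rho.
Proof.
move=> ltk; have : nth (0, 0, 0)%N (labels W) k \in labels W by rewrite mem_nth -?size_sz.
rewrite nth_labels // => /mem_labels[c /(mem_wedd_list _ _ _ sm)[t [lam]]].
rewrite -nE => -[adm [-> dimE condE]] lt_idx.
have [lamE ts] := wedd_adm_bounds adm.
have NE : (N <= n + m)%N by lia.
have mE : (m <= n + m)%N by lia.
have [A [B AB]] : exists A B : 'M_(dim k),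
    metacyclic_mx (cond k) r (roots t lam (idx k)).1 (roots t lam (idx k)).2 A B.
  rewrite dimE condE.
  exact: (metacyclic_mx_label p_pr N_gt0 sm NE mE Z_prim _ _ p_odd p'u rE).
have [Aq Bq BA _ _] := AB.
have Ak : A ^+ (p ^ n) = 1.
  have -> : (p ^ n = dim k * p ^ N * p ^ (n - (t + N)))%N.
    by rewrite dimE -!expnD; congr (_ ^ _)%N; lia.
  by rewrite !exprM Aq scalar_mxX (label_roots_w_exp p_pr N_gt0 sm NE mE Z_prim) // expr1n.
have Bl : B ^+ (p ^ m) = 1.
  have -> : (p ^ m = dim k * p ^ (m - t))%N.
    by rewrite dimE -!expnD; congr (_ ^ _)%N; lia.
  by rewrite exprM Bq scalar_mxX (label_roots_y_exp p_pr N_gt0 sm NE mE Z_prim).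
have [R [R1 RM RE]] := metacyclic_rep (pX0 n) (pX0 m) ak bl ba oG spanG Ak Bl BA.
by exists (fun g => mx_entry (R g)); exists t, lam; split=> //; exists A, B; split=> //; exists R.
Qed.

Lemma QG_wedderburn_metacyclic : QG_wedderburn gT W.
Proof.
have /fin_all_exists[f fP] : forall k : 'I_(size sz), exists rho, block_spec k rho.
  by move=> k; apply: block_spec_exists.
(* The zero default beyond the last block is never read. *)
pose rho k := if insub k is Some k' then f k' else (fun _ _ _ => 0).
have rhoP k : (k < size sz)%N -> block_spec k (rho k).
  by move=> ltk; rewrite /rho insubT; exact: (fP (Ordinal ltk)).
apply: (@QG_wedderburn_of_blocks gT W rho) => [k ltk|k i j|k g h i j|k g i j|F F0|].
- by have [t [lam [[_ _ condE _] _]]] := rhoP _ ltk; rewrite -/(cond k) condE.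
- case/and3P=> ltk lti ltj; have [t [lam [_ [A [B [_ [R [R1 _ _ ->]]]]]]]] := rhoP _ ltk.
  by rewrite -[i]/(val (Ordinal lti)) -[j]/(val (Ordinal ltj)) mx_entryE R1 mxE.
- case/and3P=> ltk lti ltj; have [t [lam [_ [A [B [_ [R [_ RM _ ->]]]]]]]] := rhoP _ ltk.
  rewrite -[i]/(val (Ordinal lti)) -[j]/(val (Ordinal ltj)) mx_entryE RM mxE.
  by apply: eq_bigr => o _; rewrite !mx_entryE.
- case/and3P=> ltk lti ltj.
  have [t [lam [[_ _ condE _] [A [B [[_ _ _ QA QB] [R [_ _ RE ->]]]]]]]] := rhoP _ ltk.
  rewrite -[i]/(val (Ordinal lti)) -[j]/(val (Ordinal ltj)) mx_entryE.
  have c_gt0 : (0 < cond k)%N by rewrite condE.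
  have [x [y ->]] := spanG g; rewrite RE.
  by apply: (Qzeta_mxM c_gt0); apply: Qzeta_mxX.
- pose G x y := F (a ^+ x * b ^+ y)%g.
  have killed t w y : (t <= s)%N -> w ^+ (p ^ N) = 1 ->
    ((0 < t)%N -> (p ^ N).-primitive_root w) -> y ^+ (p ^ (m - t)) = 1 ->
    exists A B : 'M[algC]_(p ^ t),
      [/\ A ^+ (p ^ t) = w%:M, B ^+ (p ^ t) = y%:M, B * A = A ^+ r * B
        & \sum_(i < p ^ n) \sum_(j < p ^ m) ratr (G i j) *: (A ^+ i * B ^+ j) = 0].
    move=> ts wN w_prim yM.
    have NE : (N <= n + m)%N by lia.
    have mE : (m <= n + m)%N by lia.
    have [lam [i [e [adm lti co_e wE yE]]]] :=
      label_roots_cover p_pr N_gt0 sm NE mE Z_prim ts wN w_prim yM.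
    have lab : (p ^ t, p ^ lam, i)%N \in labels W.
      apply/mem_labels; exists (wedd_mult p N m t lam) => //.
      by apply/mem_wedd_list => //; exists t, lam; rewrite -nE.
    pose k := index (p ^ t, p ^ lam, i)%N (labels W).
    have ltk : (k < size sz)%N by rewrite size_sz index_mem.
    have [dimE condE idxE] : [/\ dim k = p ^ t, cond k = p ^ lam & idx k = i]%N.
      by have := nth_labels ltk; rewrite nth_index // => -[].
    have [t' [lam' [[_ dimE' condE' _] [A [B [[Aq Bq BA _ _] [R [_ _ RE rhoE]]]]]]]] := rhoP _ ltk.
    (* [block_spec] hides t and lam; the block size and conductor determine them. *)
    have Et : t' = t.
      by apply/eqP; rewrite -(eqn_exp2l _ _ (prime_gt1 p_pr)) -dimE' dimE.
    have El : lam' = lam.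
      by apply/eqP; rewrite -(eqn_exp2l _ _ (prime_gt1 p_pr)) -condE' condE.
    rewrite Et El idxE in Aq Bq.
    have sum0 : \sum_(x < p ^ n) \sum_(y < p ^ m) ratr (G x y) *: (A ^+ x * B ^+ y) = 0.
      transitivity (\sum_g ratr (F g) *: R g).
        rewrite (big_normal_form (pX0 n) (pX0 m) ak bl oG spanG).
        by apply: eq_bigr => x _; apply: eq_bigr => y' _; rewrite RE.
      apply/matrixP=> i' j'; rewrite summxE mxE.
      rewrite -[RHS](F0 k i' j'); last by apply/and3P; split.
      by apply: eq_bigr => g _; rewrite mxE rhoE mx_entryE.
    (* The automorphism raising p^(n+m)-th roots of unity to the power e carries the labelled pair
       to (w, y). *)
    have co : coprime e (p ^ (n + m)) by rewrite coprimeXr.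
    have [v vE] := Qn_aut_exists co.
    have [A'q B'q BA' sum'] := galois_mx_sum v Aq Bq BA sum0.
    have [lamE _] := wedd_adm_bounds adm.
    have vw : v (roots t lam i).1 = w.
      rewrite vE // (_ : n + m = N + (n + m - N))%N; last by lia.
      by rewrite expnD exprM (label_roots_w_exp p_pr N_gt0 sm NE mE Z_prim) // expr1n.
    have vy : v (roots t lam i).2 = y.
      rewrite vE // (_ : n + m = (m - t) + (n + t))%N; last by lia.
      by rewrite expnD exprM (label_roots_y_exp p_pr N_gt0 sm NE mE Z_prim) // expr1n.
    rewrite -dimE; exists (map_mx v A), (map_mx v B).
    by rewrite -vw -vy.
  move=> g; have [i [j ->]] := spanG g.
  rewrite -(expg_mod i ak) -(expg_mod j bl).
  have nE' : n = (N + s)%N by rewrite nE subnK // ltnW.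
  have := fourier_faithful (F := fun x y => ratr (G x y)) p_pr p_odd N_gt0 p'u rE nE' sm killed
    (ltn_pmod i (pX0 n)) (ltn_pmod j (pX0 m)).
  by move/eqP; rewrite fmorph_eq0 => /eqP.
(* It remains to match the order of the group with the dimension of the block algebra. *)
rewrite oG -(@wedd_list_dim p n m s) //; last by rewrite leq_min sm; lia.
rewrite -/W -/sz.
transitivity (\sum_(c <- expand W) c.1 * c.1 * totient c.2)%N; last first.
  rewrite (big_nth (0, 0)%N) big_mkord size_map; apply: eq_bigr => k _.
  by rewrite (nth_map (0, 0)%N).
rewrite big_flatten big_map; apply: eq_bigr => c _.
by rewrite big_nseq iter_addn_0 mulnC.
Qed.

End MetacyclicWedderburn.

Local Close Scope ring_scope.

Theorem theorem1p1 (p n m s : nat) (r : int) (gT : finGroupType) :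
  prime p -> odd p -> (2 <= n)%N -> (1 <= m)%N ->
  coprimez r (p ^ n)%:Z ->
  is_mult_order r (p ^ n) (p ^ s) ->
  (1 <= s)%N -> (s <= minn n.-1 m)%N ->
  ([set: gT] \isog Grp (a : b : a ^+ (p ^ n), b ^+ (p ^ m),
                                a ^ b^-1 = a ^+ (resmod r (p ^ n))))%g ->
  QG_wedderburn gT (wedd_list p n m s).
Proof.
move=> p_pr p_odd n_gt1 m_gt0 _ r_ord s_gt0; rewrite leq_min => /andP[sn1 sm] presG.
have sn : (s < n)%N by rewrite -(prednK (ltnW n_gt1)) ltnS.
have N_gt0 : (0 < n - s)%N by rewrite subn_gt0.
have [u p'u rE] := resmod_principal_unit p_pr p_odd s_gt0 sn r_ord.
have pX_gt1 k : (0 < k)%N -> (1 < p ^ k)%N by move=> k0; rewrite -(exp1n k) ltn_exp2r ?prime_gt1.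
have co := principal_unit_coprime p_pr N_gt0 rE n.
(* Since s <= m, the order p^s of r divides p^m. *)
have rl1 : (resmod r (p ^ n) ^ (p ^ m) = 1 %[mod p ^ n])%N.
  have := principal_unit_expn_eq1 p_pr p_odd N_gt0 p'u rE s (p ^ m).
  by rewrite subnK ?(ltnW sn) // dvdn_exp2l // => /eqP.
have [a [b [ak bl ba [oG spanG]]]] :=
  metacyclic_generators (pX_gt1 n (ltnW n_gt1)) (pX_gt1 m m_gt0) co rl1 presG.
exact: (QG_wedderburn_metacyclic p_pr p_odd N_gt0 s_gt0 p'u rE (erefl _) sn sm ak bl ba oG spanG).
Qed.
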